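(* Let $X$ be a real Hausdorff locally convex space, $T$ a topological space, $f_t:X\to\overline{\mathbb{R}}$ ($t\in T$) convex functions, and $f:=\sup_{t\in T}f_t$. Assume that $f$ is finite and continuous at some point of $X$. Let $x\in X$ be such that for some $\varepsilon_0>0$: (i) the set $T_{\varepsilon_0}(x)$ is compact; (ii) for every $z\in\operatorname{dom}(\operatorname{cl}f)$, the function $t\mapsto(\operatorname{cl}f_t)(z)$ is upper semicontinuous on $T_{\varepsilon_0}(x)$. Then $$\partial f(x)=\mathrm{N}_{\operatorname{dom}f}(x)+\overline{\operatorname{co}}\Big\{\bigcup_{t\in T(x)}\partial f_t(x)\Big\}.$$ Moreover, when $X=\mathbb{R}^n$, $$\partial f(x)=\mathrm{N}_{\operatorname{dom}f}(x)+\operatorname{co}\Big\{\bigcup_{t\in T(x)}\partial f_t(x)\Big\}.$$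
   Context: $\overline{\mathbb{R}}=\mathbb{R}\cup\{\pm\infty\}$. $X^*$ is the topological dual of $X$, endowed with the weak*-topology, and $\langle\cdot,\cdot\rangle$ is the canonical pairing. For a convex $\varphi:X\to\overline{\mathbb{R}}$: $\operatorname{dom}\varphi=\{x\in X:\varphi(x)<+\infty\}$; $\operatorname{cl}\varphi$ is the lower semicontinuous envelope of $\varphi$; the subdifferential is $\partial\varphi(x)=\{x^*\in X^*:\varphi(y)-\varphi(x)\ge\langle x^*,y-x\rangle\ \forall y\in X\}$ if $\varphi(x)\in\mathbb{R}$, and $\partial\varphi(x)=\emptyset$ if $\varphi(x)\notin\mathbb{R}$. For a convex set $A\subset X$, the normal cone is $\mathrm{N}_A(x)=\{x^*\in X^*:\langle x^*,y-x\rangle\le0\ \forall y\in A\}$ if $x\in A$, and $\mathrm{N}_A(x)=\emptyset$ if $x\notin A$. Sums of sets are Minkowski sums (empty if one summand is empty). $\operatorname{co}$ is the convex hull and $\overline{\operatorname{co}}$ the closed convex hull (weak*-closed for subsets of $X^*$). Active index sets: $T_\varepsilon(x)=\{t\in T: f_t(x)\ge f(x)-\varepsilon\}$ for $\varepsilon\ge0$, and $T(x)=\{t\in T: f_t(x)=f(x)\}$. *)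

(* Defs.v *)
From HB Require Import structures.
From mathcomp Require Import all_boot all_order all_algebra.
From mathcomp Require Import all_classical all_reals all_analysis.

Set Implicit Arguments.
Unset Strict Implicit.
Unset Printing Implicit Defensive.

Import Order.TTheory GRing.Theory Num.Theory.
Import numFieldNormedType.Exports.

Local Open Scope classical_set_scope.
Local Open Scope ring_scope.

Section TopologicalDual.
Context {R : realType}.
Implicit Types X : tvsType R.

Definition dual_pred X : {pred X -> R^o} :=
  fun l => `[< linear l /\ continuous l >].

Lemma dual_submod_closed X : submod_closed (@dual_pred X).
Proof.
split=> [|a u v /asboolP[lu cu] /asboolP[lv cv]]; apply/asboolP; split.
- by move=> a u v /=; rewrite scaler0 addr0.
- by move=> x; exact: (@cvg_cst R^o).
- move=> b x y; change (a *: u (b *: x + y) + v (b *: x + y) =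
    b *: (a *: u x + v x) + (a *: u y + v y)).
  rewrite lu lv !scalerDr !scalerA (mulrC a b) -!addrA; congr (_ + _).
  by rewrite addrCA.
- move=> x; change ((fun z : X => a *: u z + v z) @ x --> a *: u x + v x).
  by apply: cvgD; [apply: cvgZl_tmp; exact: cu | exact: cv].
Qed.

HB.instance Definition _ X :=
  GRing.isSubmodClosed.Build R (X -> R^o) (@dual_pred X)
    (@dual_submod_closed X).

Record dual X := Dual { dual_fun :> X -> R^o; _ : dual_fun \in @dual_pred X }.

HB.instance Definition _ X := [isSub for @dual_fun X].
HB.instance Definition _ X := [Choice of dual X by <:].
HB.instance Definition _ X := [SubChoice_isSubLmodule of dual X by <:].

(* The topology of [dual X] is the weak* one: it is induced by pointwise
   convergence on X. *)
HB.instance Definition _ X := Topological.copy (dual X)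
  (initial_topology (fun l : dual X => (l : {ptws X -> R^o}))).

End TopologicalDual.

Section ConvexAnalysis.
Context {R : realType}.
Local Open Scope ereal_scope.

(* Convexity of the epigraph: the values -oo and +oo are both allowed. *)
Definition convex_efun (X : lmodType R) (phi : X -> \bar R) : Prop :=
  convex_set [set p : X * R^o | phi p.1 <= (p.2 : R)%:E].

Definition edom (X : Type) (phi : X -> \bar R) : set X :=
  [set x | phi x < +oo].

(* The greatest lower semicontinuous minorant of phi. *)
Definition lsc_envelope (X : topologicalType) (phi : X -> \bar R) (x : X) :
    \bar R :=
  ereal_sup [set g x | g in [set g : X -> \bar R |
    lower_semicontinuous g /\ forall y, g y <= phi y]].

(* Upper semicontinuity of the restriction of g to A (subspace topology). *)
Definition upper_semicontinuous_on (T : topologicalType) (A : set T)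
    (g : T -> \bar R) : Prop :=
  forall t, A t -> forall a : R, g t < a%:E ->
    \forall s \near within A (nbhs t), g s < a%:E.

Definition subdifferential (X : tvsType R) (phi : X -> \bar R) (x : X) :
    set (dual X) :=
  [set l | phi x \is a fin_num /\
           forall y, (l (y - x)%R : R)%:E <= phi y - phi x].

Definition normal_cone (X : tvsType R) (A : set X) (x : X) : set (dual X) :=
  [set l | A x /\ forall y, A y -> ((l (y - x) : R) <= 0)%R].

Definition minkowski_sum (V : zmodType) (A B : set V) : set V :=
  [set (a + b)%R | a in A & b in B].

Definition convex_hull (V : lmodType R) (A : set V) : set V :=
  smallest (fun B : set V => convex_set B) A.

Definition weakstar_closed_convex_hull (X : tvsType R) (A : set (dual X)) :
    set (dual X) :=
  closure (convex_hull A).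

Definition sup_fun (X T : Type) (f_ : T -> X -> \bar R) (x : X) : \bar R :=
  ereal_sup (range (fun t => f_ t x)).

Definition eps_active (X T : Type) (f_ : T -> X -> \bar R) (eps : R) (x : X) :
    set T :=
  [set t | sup_fun f_ x - eps%:E <= f_ t x].

Definition active (X T : Type) (f_ : T -> X -> \bar R) (x : X) : set T :=
  [set t | f_ t x = sup_fun f_ x].

End ConvexAnalysis.

(* Main.v *)
Require Import Defs.
From HB Require Import structures.
From mathcomp Require Import all_boot all_order all_algebra.
From mathcomp Require Import all_classical all_reals all_analysis.
From mathcomp Require Import ring lra.
Import Order.TTheory GRing.Theory Num.Theory.
Import numFieldNormedType.Exports.
Local Open Scope classical_set_scope.
Local Open Scope ring_scope.
Set Implicit Arguments.
Unset Strict Implicit.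
Unset Printing Implicit Defensive.

(** Let [l] be a subgradient at [x] of the supremum [f] of the [f_t], and let
    [D] be the domain of [f].  The task is to find [b] in the (closed) convex
    hull of the subgradients at [x] of the active functions such that
    [l (y - x) <= b (y - x)] for all [y] in [D]; then [l = (l - b) + b] with
    [l - b] normal to [D] at [x].  After a translation, [x = 0] and [f 0 = 0].
    The points near which all the [f_t] are bounded by a common constant form
    a nonempty set, by the continuity of [f] somewhere, and every point of [D]
    is the end of a segment of such interior points; hence it is enough to
    treat interior points [y].  There each [f_t] agrees with its lower
    semicontinuous envelope, so that [t |-> f_t y] is upper semicontinuous.

    One interior point.  As [s] decreases to 0, choose indices [t] such that
    [f_t (s y)] is nearly above [s (l y)].  By compactness they have a cluster
    point [t], which is active and satisfies [s (l y) <= f_t (s y)] for all [s]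
    in [[0, 1]] ([ex_active_above]).  As [y] is interior, the directional
    derivative of [f_t] along [y] is attained by a subgradient [b], which is
    thus such that [l y <= b y] ([ex_active_minorant], from the theorem
    [sandwich]).

    All interior points.  A finite minimax argument ([finite_minimax]) turns
    the preceding step, applied to the convex combinations of finitely many
    points [y_i], into one [b] in the convex hull that is nearly above [l] at
    all the [y_i].  The elements of the hull are uniformly bounded above near
    an interior point, so an ultrafilter that is finer than these conditions
    converges pointwise to a continuous form ([ultra_dual_limit]), which is in
    the closed hull and is above [l] at every interior point.

    Finite dimension.  By Caratheodory ([caratheodory]) the elements of the
    hull are combinations of [n + 1] active subgradients, and the limit is
    taken in each term separately ([active_family_limit]).  A term whose weight
    has a positive limit converges to a form below some active [f_t] on [D],
    which [sandwich] replaces by a subgradient of [f_t]; a term whose weight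
    tends to 0 converges to a form that is nonpositive on [D] and can be
    dropped.  Both replacements only increase the values on [D], so that no
    closure is needed.

    Everything rests on one form of the Hahn-Banach theorem
    ([hahn_banach_cone]). *)

(** * The Hahn-Banach theorem *)

Section HahnBanach.
Context {R : realType} {V : lmodType R}.
Implicit Types S : set (V * R).

Let proper_cone S := [/\
  forall u v a b, S (u, a) -> S (v, b) -> S (u + v, a + b),
  forall s u a, 0 < s -> S (u, a) -> S (s *: u, s * a) &
  forall a, S (0, a) -> 0 <= a].

Let proper_cone_bigcup (F : set (set (V * R))) S0 : proper_cone S0 ->
  (forall S, F S -> proper_cone (S `|` S0)) -> total_on F subset ->
  proper_cone (\bigcup_(S in F) S `|` S0).
Proof.
move=> c0 cF totF; split.
- move=> u v a b [[S FS Su]|Su] [[S' FS' Sv]|Sv].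
  + have [SS'|S'S] := totF _ _ FS FS'.
      have [add _ _] := cF _ FS'.
      by case: (add u v a b (or_introl (SS' _ Su)) (or_introl Sv)) => ?;
        [left; exists S'|right].
    have [add _ _] := cF _ FS.
    by case: (add u v a b (or_introl Su) (or_introl (S'S _ Sv))) => ?;
      [left; exists S|right].
  + have [add _ _] := cF _ FS.
    by case: (add u v a b (or_introl Su) (or_intror Sv)) => ?;
      [left; exists S|right].
  + have [add _ _] := cF _ FS'.
    by case: (add u v a b (or_intror Su) (or_introl Sv)) => ?;
      [left; exists S'|right].
  + by have [add _ _] := c0; right; exact: add.
- move=> s u a s0 [[S FS Su]|Su].
    have [_ scal _] := cF _ FS.
    by case: (scal s u a s0 (or_introl Su)) => ?; [left; exists S|right].
  by have [_ scal _] := c0; right; exact: scal.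
- move=> a [[S FS Sa]|Sa]; last by have [_ _] := c0; apply.
  by have [_ _] := cF _ FS; apply; left.
Qed.

(** Hahn-Banach with the sublinear functional replaced by a convex cone [S0]
    of pairs (vector, upper bound), which spares every application the
    computation of an infimum.  A maximal proper cone [S] above [S0] is the
    epigraph of a linear form: put [l v := inf {a | (v, a) \in S}].  Adding
    [(- v, - l v)] to [S] keeps it proper, so that this pair is already in [S];
    hence [l] is odd, and an odd sublinear function is linear. *)
Theorem hahn_banach_cone S0 :
  S0 (0, 0) -> (forall v, exists a, S0 (v, a)) ->
  (forall u v a b, S0 (u, a) -> S0 (v, b) -> S0 (u + v, a + b)) ->
  (forall s u a, 0 < s -> S0 (u, a) -> S0 (s *: u, s * a)) ->
  (forall a, S0 (0, a) -> 0 <= a) ->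
  exists l : V -> R^o, linear l /\ forall v a, S0 (v, a) -> l v <= a.
Proof.
move=> S00 S0tot S0add S0scal S0pos.
have c0 : proper_cone S0 by [].
have [F FP Ftot|A [/= cA maxA]] := @Zorn_bigcup _ [set S | proper_cone (S `|` S0)].
  exact: proper_cone_bigcup.
move: cA; set S := A `|` S0 => cS.
have maxS B : S `<=` B -> proper_cone B -> B `<=` S.
  move=> SB cB; have AB : A `<=` B by move=> p Ap; apply: SB; left.
  have [BA|nBA] := pselect (B `<=` A); first by move=> p /BA; left.
  exfalso; apply: (maxA B); first by split.
  rewrite /= (_ : B `|` S0 = B)//; apply/setUidl => p S0p.
  by apply: SB; right.
have [Sadd Sscal Spos] := cS.
have Stot v : exists a, S (v, a) by have [a] := S0tot v; exists a; right.
have S0' : S (0, 0) by right.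
pose E v := [set a | S (v, a)].
have Elb v : has_inf (E v).
  split; first exact: Stot.
  have [b Sb] := Stot (- v); exists (- b) => a Sa.
  by have := Spos (a + b); rewrite -(subrr v) => /(_ (Sadd _ _ _ _ Sa Sb)); lra.
pose l v : R^o := inf (E v).
have l_le v a : S (v, a) -> l v <= a by move=> Sa; apply: ge_inf => //; case: (Elb v).
(* By maximality it is enough that the cone B spanned by S and (- v, - l v) is
   proper. *)
have SNl v : S (- v, - l v).
  pose B := [set p : V * R | exists u a s,
    [/\ 0 <= s, S (u, a) & p = (u - s *: v, a - s * l v)]].
  apply: (maxS B).
  - by move=> [u a] Su; exists u, a, 0; rewrite scale0r mul0r !subr0.
  - split.
    + move=> _ _ _ _ [u [a [s [s0 Su [-> ->]]]]] [w [b [r [r0 Sw [-> ->]]]]].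
      exists (u + w), (a + b), (s + r); split; [exact: addr_ge0|exact: Sadd|].
      by congr (_, _); [rewrite scalerDl opprD addrACA|ring].
    + move=> k _ _ k0 [u [a [s [s0 Su [-> ->]]]]].
      exists (k *: u), (k * a), (k * s); split;
        [by rewrite mulr_ge0// ltW|exact: Sscal|].
      by congr (_, _); [rewrite scalerBr scalerA|ring].
    + move=> _ [u [a [s [s0 Su [/esym/eqP + ->]]]]].
      rewrite subr_eq0 => /eqP uE; move: s0; rewrite le_eqVlt => /predU1P[s0|s0].
        by rewrite -s0 mul0r subr0; apply: Spos; move: Su; rewrite uE -s0 scale0r.
      have si0 : 0 < s^-1 by rewrite invr_gt0.
      have := Sscal _ _ _ si0 Su; rewrite uE scalerA mulVf ?gt_eqF// scale1r.
      move=> /l_le; rewrite -(ler_pM2l s0) mulrA divff ?gt_eqF// mul1r.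
      by rewrite subr_ge0.
  - by exists 0, 0, 1; rewrite scale1r mul1r !sub0r.
have lN v : l (- v) = - l v.
  apply/eqP; rewrite eq_le (l_le _ _ (SNl v)) /=.
  rewrite lerNl; apply: lb_le_inf => [|a Sa]; first exact: Stot.
  rewrite lerNl; apply: lb_le_inf => [|b Sb]; first exact: Stot.
  by have := Spos (a + b); rewrite -(subrr v) => /(_ (Sadd _ _ _ _ Sa Sb)); lra.
have Sl v : S (v, l v) by have := SNl (- v); rewrite lN !opprK.
have lD u v : l (u + v) = l u + l v.
  apply/eqP; rewrite eq_le (l_le _ _ (Sadd _ _ _ _ (Sl u) (Sl v))) /=.
  have := l_le _ _ (Sadd _ _ _ _ (SNl u) (SNl v)).
  by rewrite -opprD lN -opprD lerN2.
have l0 : l 0 = 0 by apply: (addrI (l 0)); rewrite -lD !addr0.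
have lZp s v : 0 < s -> l (s *: v) = s * l v.
  move=> s0; apply/eqP; rewrite eq_le (l_le _ _ (Sscal _ _ _ s0 (Sl v))) /=.
  have := l_le _ _ (Sscal _ _ _ s0 (SNl v)).
  by rewrite scalerN lN mulrN lerN2.
exists l; split; last by move=> v a S0v; apply: l_le; right.
move=> s u v; rewrite lD; congr (_ + _).
have [s0|s0|<-] := ltgtP 0 s; last by rewrite !scale0r l0.
  exact: lZp.
by apply: oppr_inj; rewrite -lN -scaleNr lZp ?oppr_gt0// -scaleNr.
Qed.

End HahnBanach.

(** * Convexity and topological vector spaces *)

Section Convexity.
Context {R : realType}.

Lemma convex_setP {V : lmodType R} (A : set V) : convex_set A <->
  forall (s : R) u v, 0 <= s -> s <= 1 -> A u -> A v ->
    A (s *: u + (1 - s) *: v).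
Proof.
split=> [cA s u v s0 s1 Au Av|cA u v s /set_mem Au /set_mem Av].
  exact/set_mem/(cA u v (Itv01 s0 s1) (mem_set Au) (mem_set Av)).
exact/mem_set/cA.
Qed.

Lemma convex_efunP {X : lmodType R} (phi : X -> \bar R) : convex_efun phi <->
  forall (s : R) u v (a b : R), 0 <= s -> s <= 1 ->
    (phi u <= a%:E)%E -> (phi v <= b%:E)%E ->
    (phi (s *: u + (1 - s) *: v)%R <= (s * a + (1 - s) * b)%:E)%E.
Proof.
split=> [/convex_setP cphi s u v a b s0 s1 pu pv|cphi].
  exact: (cphi s (u, a) (v, b)).
by apply/convex_setP => s [u a] [v b] s0 s1; exact: cphi.
Qed.

Lemma convex_efun_barycenter {X : lmodType R} (phi : X -> \bar R) s r u v
    (a b : R) : convex_efun phi -> 0 < s -> 0 < r ->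
    (phi u <= a%:E)%E -> (phi v <= b%:E)%E ->
  (phi ((s + r)^-1 *: (s *: u + r *: v))%R <= ((s * a + r * b) / (s + r))%:E)%E.
Proof.
move=> /convex_efunP cphi s0 r0 pu pv.
have sr0 : s + r != 0 by rewrite gt_eqF// addr_gt0.
have -> : (s + r)^-1 *: (s *: u + r *: v) =
    (s / (s + r)) *: u + (1 - s / (s + r)) *: v.
  rewrite scalerDr !scalerA mulrC; congr (_ + _ *: _).
  by field.
have -> : (s * a + r * b) / (s + r) = s / (s + r) * a + (1 - s / (s + r)) * b.
  by field.
apply: cphi => //; first by rewrite divr_ge0// ltW// addr_gt0.
by rewrite ler_pdivrMr ?addr_gt0// mul1r lerDl ltW.
Qed.

Lemma convex_sum {V : lmodType R} (A : set V) n (w : 'I_n -> R) (v : 'I_n -> V) :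
  convex_set A -> (forall i, 0 <= w i) -> \sum_i w i = 1 ->
  (forall i, A (v i)) -> A (\sum_i w i *: v i).
Proof.
move=> /convex_setP cA w0 w1 Av.
(* P says that (total weight, weighted sum) lies in the cone over {1} * A,
   which is stable under sums without any renormalization. *)
pose P (p : R * V) := 0 <= p.1 /\ (p = 0 \/ 0 < p.1 /\ A (p.1^-1 *: p.2)).
have : P (\sum_i (w i, w i *: v i)).
  apply: (big_ind P); first by split=> //; left.
  - move=> [s u] [r z] [/= s0 [[-> ->]|[sp Au]]] [/= r0 [[-> ->]|[rp Az]]].
    + by rewrite addr0; split => //; left.
    + by rewrite add0r; split => //; right.
    + by rewrite addr0; split => //; right.
    + split; [exact: addr_ge0|right; split; first exact: addr_gt0].
      rewrite /=; have -> : (s + r)^-1 *: (u + z) = (s / (s + r)) *: (s^-1 *: u) +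
          (1 - s / (s + r)) *: (r^-1 *: z).
        rewrite !scalerA scalerDr; congr (_ *: _ + _ *: _); field.
          by rewrite !gt_eqF// addr_gt0.
        by rewrite !gt_eqF// addr_gt0.
      apply: cA => //; first by rewrite divr_ge0// ltW// addr_gt0.
      by rewrite ler_pdivrMr ?addr_gt0// mul1r lerDl ltW.
  - move=> i _; split=> //=; have := w0 i; rewrite le_eqVlt => /predU1P[<-|wi].
      by left; rewrite scale0r.
    by right; split => //; rewrite scalerA mulVf ?gt_eqF// scale1r.
have -> : \sum_i (w i, w i *: v i) = (1, \sum_i w i *: v i).
  rewrite -w1; elim/big_rec3: _ => // i x y _ _ ->; congr (_, _).
by move=> [_ [[/eqP]|[_]]]; rewrite ?oner_eq0//= invr1 scale1r.
Qed.

End Convexity.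

Lemma linear_bundle {R : realType} {V W : lmodType R} (l : V -> W) :
  linear l -> exists L : {linear V -> W}, l = L.
Proof.
move=> lin_l.
by exists (HB.pack_for {linear V -> W} l (GRing.isLinear.Build _ _ _ _ l lin_l)).
Qed.

Section TopologicalVectorSpaces.
Context {R : realType} {X : tvsType R}.
Implicit Types (x y z : X).

Lemma cvg_scale_add {T} (F : set_system T) {FF : Filter F} (k : T -> R^o)
    (u : T -> X) (k0 : R^o) (u0 w : X) :
  k @ F --> k0 -> u @ F --> u0 ->
  (fun t => k t *: u t + w) @ F --> k0 *: u0 + w.
Proof.
move=> ck cu; apply: (@continuous2_cvg _ X X X F FF _ _ (fun a b => a + b)).
- exact: (@add_continuous X (k0 *: u0, w)).
- apply: (@continuous2_cvg _ R^o X X F FF _ _ (fun a b => a *: b)) => //.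
  exact: (@scale_continuous R X (k0, u0)).
- exact: cvg_cst.
Qed.

Lemma nbhs_ray y z (V : set X) : nbhs y V -> exists2 k : R, 0 < k & V (k *: z + y).
Proof.
have: (fun k : R^o => k *: z + y) @ (0 : R^o) --> 0 *: z + y.
  by apply: cvg_scale_add; [exact: cvg_id|exact: cvg_cst].
rewrite scale0r add0r => cv Vy; have /nbhs_ballP[e /= e0 He] := cv V Vy.
exists (e / 2); first by rewrite divr_gt0.
apply: He; rewrite /ball /= sub0r normrN gtr0_norm ?divr_gt0//.
by rewrite ltr_pdivrMr// mulr_natr mulr2n ltrDl.
Qed.

Lemma nbhs_scaling (s : R) u y (V : set X) : nbhs (s *: y + u) V ->
  \forall z \near y, V (s *: z + u).
Proof.
have: (fun z => s *: z + u) @ y --> s *: y + u.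
  by apply: cvg_scale_add; [exact: cvg_cst|exact: cvg_id].
exact.
Qed.

(** Averaging the bound at [y + u] and [y - u] bounds [l] on both sides near 0,
    and linearity turns such a bound into continuity. *)
Lemma linear_near_bounded_continuous (l : X -> R^o) y (M : R) : linear l ->
  (\forall z \near y, l z <= M) -> continuous l.
Proof.
move=> lin_l lM.
have [L lE] := linear_bundle lin_l.
have [c c0 Vc] : exists2 c, 0 < c & \forall u \near (0 : X), `|L u| <= c.
  exists (`|M - l y| + 1); first by rewrite ltr_pwDr.
  have H s : \forall u \near (0 : X), l (s *: u + y) <= M.
    by apply: (@nbhs_scaling s y 0 [set z | l z <= M]); rewrite scaler0 add0r.
  near=> u.
  have : l (1 *: u + y) <= M by near: u; exact: H.
  have : l (-1 *: u + y) <= M by near: u; exact: H.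
  have H3 := ler_norm (M - l y); move: H3.
  rewrite lE !linearD !linearZ /= scaleN1r scale1r => H3 H1 H2; rewrite ler_norml.
  apply/andP; split; lra.
move=> x; rewrite lE; apply/cvgrPdist_le => e e0.
have /nbhs_scaling : nbhs ((c / e) *: x + - ((c / e) *: x)) [set u | `|L u| <= c].
  by rewrite subrr.
apply: filterS => z /=; rewrite -scalerBr linearZ/= linearB/= normrZ.
by rewrite gtr0_norm ?divr_gt0// mulrAC ler_pdivrMr// ler_pM2l// distrC.
Unshelve. all: by end_near. Qed.

End TopologicalVectorSpaces.

(** * Sandwich and minimax theorems *)

Section Dual.
Context {R : realType} {X : tvsType R}.
Implicit Types (b c : dual X).

Lemma dual_linear b : linear b.
Proof. by case: b => /= l /asboolP[]. Qed.

Lemma ex_dual (l : X -> R^o) : linear l -> continuous l ->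
  exists b : dual X, forall z, b z = l z.
Proof.
move=> lin_l cl; have ld : l \in @dual_pred R X by apply/asboolP.
by exists (Dual ld).
Qed.

Lemma dual_sum n (w : 'I_n -> R) (b : 'I_n -> dual X) z :
  (\sum_i w i *: b i) z = \sum_i w i * b i z.
Proof. by elim/big_rec2: _ => // i x y _ <-. Qed.

Lemma dual_appD b u v : b (u + v) = b u + b v.
Proof. by have [L ->] := linear_bundle (dual_linear b); rewrite linearD. Qed.

Lemma dual_appZ b (s : R) u : b (s *: u) = s * b u.
Proof. by have [L ->] := linear_bundle (dual_linear b); rewrite linearZ. Qed.

Lemma dual_app0 b : b 0 = 0.
Proof. by have [L ->] := linear_bundle (dual_linear b); rewrite linear0. Qed.

Lemma dual_app_sum b n (w : 'I_n -> R) (u : 'I_n -> X) :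
  b (\sum_i w i *: u i) = \sum_i w i * b (u i).
Proof.
have [L ->] := linear_bundle (dual_linear b).
by rewrite linear_sum; apply: eq_bigr => i _; rewrite linearZ.
Qed.

Lemma dual_halfspace_convex z (a : R) : convex_set [set b : dual X | b z <= a].
Proof.
apply/convex_setP => s b c s0 s1 /= bz cz.
change (s * b z + (1 - s) * c z <= a).
have := ler_wpM2l s0 bz; have := ler_wpM2l (_ : 0 <= 1 - s) cz.
by rewrite subr_ge0 => /(_ s1); lra.
Qed.

End Dual.

Section Sandwich.
Context {R : realType} {X : tvsType R}.

(** This is the sum rule for [phi] plus the indicator of [D], phrased without
    sums: [b] is the part of [l] that belongs to [phi], and [l - b] is normal to
    [D] at 0.  Linear forms below the cone [S] of the proof are the solutions
    [b]: taking [d2 = 0] gives [b <= phi] and taking [d1 = 0] gives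
    [l <= b] on [D].  The point [y], near which [phi] is bounded, makes the cone
    project onto the whole space and makes [b] continuous. *)
Theorem sandwich (phi : X -> \bar R) (D : set X) (l : dual X) y (M : R) :
  convex_efun phi -> (phi 0%R <= 0)%E ->
  convex_set D -> D 0 -> (forall z, D z -> (l z : R)%:E <= phi z)%E ->
  D y -> (\forall z \near y, phi z <= M%:E)%E ->
  exists b : dual X,
    (forall z, (b z : R)%:E <= phi z)%E /\ forall z, D z -> l z <= b z.
Proof.
move=> cphi phi0 /convex_setP cD D0 lphi Dy phiM.
have ck k z : 0 <= k -> k <= 1 -> D z -> D (k *: z).
  by move=> k0 k1 Dz; rewrite -[_ *: _]addr0 -(scaler0 _ (1 - k)); exact: cD.
pose S (p : X * R) := exists s r d1 d2, [/\ 0 < s, 0 < r, D d2,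
  p.1 = s *: d1 - r *: d2 & (phi d1 <= ((p.2 + r * l d2) / s)%:E)%E].
have [|v|u v a b|k u a k0|a|b [lin_b bS]] := @hahn_banach_cone R X S.
- exists 1, 1, 0, 0; split=> //; first by rewrite scaler0 subrr.
  by rewrite dual_app0 mulr0 addr0 mul0r.
- have [k k0 phik] := nbhs_ray v phiM.
  exists ((M - l y) / k), k^-1, k^-1, (k *: v + y), y.
  split; rewrite ?invr_gt0 //=.
    by rewrite -scalerBr addrK scalerA mulVf ?scale1r// gt_eqF.
  apply: (le_trans phik); rewrite lee_fin le_eqVlt; apply/orP; left; apply/eqP.
  by field; rewrite gt_eqF.
- move=> [s [r [d1 [d2 [/= s0 r0 Dd2 -> phid1]]]]].
  move=> [s' [r' [e1 [e2 [/= s'0 r'0 De2 -> phie1]]]]].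
  exists (s + s'), (r + r'), ((s + s')^-1 *: (s *: d1 + s' *: e1)),
    ((r + r')^-1 *: (r *: d2 + r' *: e2)).
  have ss0 : 0 < s + s' by rewrite addr_gt0.
  have rr0 : 0 < r + r' by rewrite addr_gt0.
  split => //=.
  + have -> : (r + r')^-1 *: (r *: d2 + r' *: e2) =
      (r / (r + r')) *: d2 + (1 - r / (r + r')) *: e2.
      rewrite scalerDr !scalerA mulrC; congr (_ + _ *: _).
      by field; rewrite gt_eqF.
    apply: cD => //; first by rewrite divr_ge0// ltW.
    by rewrite ler_pdivrMr// mul1r lerDl ltW.
  + by rewrite !scalerA !divff ?gt_eqF// !scale1r opprD addrACA.
  + apply: (le_trans (convex_efun_barycenter cphi s0 s'0 phid1 phie1)).
    rewrite lee_fin le_eqVlt; apply/orP; left; apply/eqP.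
    rewrite dual_appZ dual_appD !dual_appZ.
    by field; rewrite !gt_eqF.
- move=> [s [r [d1 [d2 [/= s0 r0 Dd2 -> phid1]]]]].
  exists (k * s), (k * r), d1, d2; split; rewrite ?mulr_gt0//=.
    by rewrite scalerBr !scalerA.
  apply: (le_trans phid1); rewrite lee_fin le_eqVlt; apply/orP; left; apply/eqP.
  by field; rewrite !gt_eqF.
- move=> [s [r [d1 [d2 [/= s0 r0 Dd2 /esym/eqP + phid1]]]]].
  rewrite subr_eq0 => /eqP sd1.
  have d1E : d1 = (r / s) *: d2.
    by rewrite mulrC -scalerA -sd1 scalerA mulVf ?scale1r// gt_eqF.
  have sr : 0 < r / s by rewrite divr_gt0.
  suff : (l d1 <= (a + r * l d2) / s).
    rewrite d1E dual_appZ -mulrA (mulrC s^-1) mulrA ler_pM2r ?invr_gt0//.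
    by rewrite lerDr.
  (* D is only convex, so that d1 may lie beyond d2 on the ray of d2; the
     convexity of phi then compares phi d1 with phi d2. *)
  have [rs1|rs1] := leP (r / s) 1.
    rewrite -lee_fin; apply: le_trans phid1; apply: lphi.
    by rewrite d1E; apply: ck => //; exact: ltW.
  have : (phi ((s / r) *: d1 + (1 - s / r) *: 0)%R <=
    ((s / r) * ((a + r * l d2) / s) + (1 - s / r) * 0)%:E)%E.
    move/convex_efunP: cphi; apply => //; first by rewrite divr_ge0// ltW.
    by rewrite ler_pdivrMr// mul1r; move: rs1; rewrite ltr_pdivlMr// mul1r => /ltW.
  have sd : (s / r) *: d1 + (1 - s / r) *: 0 = d2.
    by rewrite scaler0 addr0 d1E scalerA mulrA divfK ?divff ?scale1r ?gt_eqF.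
  rewrite sd => /(le_trans (lphi _ Dd2)); rewrite lee_fin mulr0 addr0 => H.
  rewrite d1E dual_appZ -(ler_pM2l (divr_gt0 s0 r0)).
  by rewrite mulrA (_ : s / r * (r / s) = 1) ?mul1r//; field; rewrite !gt_eqF.
have bphi z a : (phi z <= a%:E)%E -> b z <= a.
  move=> phiz; apply: bS; exists 1, 1, z, 0; split => //.
    by rewrite scale1r scaler0 subr0.
  by rewrite dual_app0 mulr0 addr0 divr1.
have [|b' b'E] := ex_dual lin_b.
  apply: (@linear_near_bounded_continuous _ _ _ y M) => //.
  by apply: filterS phiM => z; exact: bphi.
exists b'; split => z; rewrite b'E.
  case phiz : (phi z) => [r| |]; first by rewrite lee_fin; apply: bphi; rewrite phiz.
    by rewrite leey.
  by exfalso; have := @bphi z (b z - 1); rewrite phiz leNye => /(_ isT); lra.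
move=> Dz; have [L LE] := linear_bundle lin_b.
rewrite -lerN2 -[X in X <= _]mulN1r -[leLHS]/(-1 *: b z).
have <- : b (- z) = -1 *: b z by rewrite LE linearN scaleN1r.
apply: bS; exists 1, 1, 0, z; split => //; first by rewrite scaler0 sub0r scale1r.
by rewrite /= mul1r addNr mul0r.
Qed.

End Sandwich.

Section Minimax.
Context {R : realType} {E : lmodType R}.

(** If no point of [C] made all the [L i] exceed [- e], then the function
    [v |-> inf_(s, b) max_i (v_i - s L_i b) - s e] on [R^m] would be sublinear
    and real valued.  A linear form below it is a weight vector [w] in the
    simplex, because it is at most [max_i v_i], and it satisfies
    [\sum_i w_i L_i b <= - e] on [C]. *)
Theorem finite_minimax (C : set E) m (L : 'I_m -> E -> R) (e : R) :
  convex_set C -> C !=set0 ->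
  (forall i s u v, L i (s *: u + (1 - s) *: v) = s * L i u + (1 - s) * L i v) ->
  (forall w : 'I_m -> R, (forall i, 0 <= w i) -> \sum_i w i = 1 ->
     exists2 b, C b & 0 <= \sum_i w i * L i b) ->
  0 < e -> exists2 b, C b & forall i, - e < L i b.
Proof.
move=> /convex_setP cC [b0 Cb0] aff wC e0; apply: contrapT => noC.
have exi b : C b -> exists i, L i b <= - e.
  move=> Cb; apply: contrapT => /forallNP H; apply: noC; exists b => // i.
  by rewrite ltNge; apply/negP; exact: H.
pose S (p : 'rV[R]_m * R) := exists s b, [/\ 0 <= s, C b &
  forall i, p.1 0 i - s * L i b - s * e <= p.2].
have [|v|u v a a'|k u a k0|a|l [lin_l lS]] := @hahn_banach_cone R _ S.
- by exists 0, b0; split => // i; rewrite mxE !mul0r !subr0.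
- exists (\sum_i `|v 0 i|), 0, b0; split => // i; rewrite !mul0r !subr0/=.
  rewrite (bigD1 i)//= (le_trans (ler_norm _))// lerDl sumr_ge0//.
- move=> [s [b [s0 Cb /= Hs]]] [r [c [r0 Cc /= Hr]]].
  have [sr0|sr] := eqVneq (s + r) 0.
    have [s00 r00] : s = 0 /\ r = 0 by split; lra.
    exists 0, b; split => // i; have := Hs i; have := Hr i.
    by rewrite s00 r00 !mul0r !subr0 /= mxE; lra.
  have srp : 0 < s + r by rewrite lt_neqAle eq_sym sr addr_ge0.
  exists (s + r), ((s / (s + r)) *: b + (1 - s / (s + r)) *: c); split.
  + exact: addr_ge0.
  + apply: cC => //; first by rewrite divr_ge0// ltW.
    by rewrite ler_pdivrMr// mul1r lerDl.
  + move=> i /=; rewrite aff.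
    have -> : (s + r) * (s / (s + r) * L i b + (1 - s / (s + r)) * L i c) =
      s * L i b + r * L i c by field.
    by have := Hs i; have := Hr i; rewrite mxE; lra.
- move=> [s [b [s0 Cb /= Hs]]]; exists (k * s), b; split => //.
    by rewrite mulr_ge0// ltW.
  by move=> i /=; have := Hs i; rewrite -(ler_pM2l k0) mxE; lra.
- move=> [s [b [s0 Cb /= Hs]]]; have [i Li] := exi _ Cb.
  have := Hs i; rewrite mxE; have := ler_wpM2l s0 Li; lra.
have [l' lE] := linear_bundle lin_l; rewrite lE in lS.
pose w i := l' (delta_mx 0 i).
have lw v : l' v = \sum_i w i * v 0 i.
  rewrite [in LHS](row_sum_delta v) linear_sum; apply: eq_bigr => i _.
  by rewrite linearZ /= mulrC.
have [||b Cb] := wC w.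
- move=> i; rewrite -oppr_le0 /w -linearN; apply: lS; exists 0, b0; split => // j.
  by rewrite !mul0r !subr0 /= !mxE; case: eqP => _; case: eqP => _ /=; lra.
- have w1 : \sum_i w i = l' (const_mx 1).
    by rewrite lw; apply: eq_bigr => i _; rewrite mxE mulr1.
  apply/eqP; rewrite w1 eq_le; apply/andP; split.
    by apply: lS; exists 0, b0; split => // j; rewrite !mul0r !subr0 mxE.
  rewrite -lerN2 -linearN; apply: lS; exists 0, b0; split => // j.
  by rewrite !mul0r !subr0 !mxE.
apply/negP; rewrite -ltNge.
have := lS (\row_i L i b) (- e); rewrite lw.
under eq_bigr do rewrite mxE.
move=> /(_ _)/le_lt_trans; apply; last by rewrite oppr_lt0.
by exists 1, b; split => // i; rewrite mxE /= !mul1r; lra.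
Qed.

End Minimax.

(** * Limits in the dual space *)

Section WeakStarTopology.
Context {R : realType} {X : tvsType R}.

Lemma dual_eval_continuous (z : X) : continuous (fun b : dual X => (b z : R^o)).
Proof.
move=> b.
apply: (@continuous_comp (dual X) {ptws X -> R^o} R^o
  (fun b : dual X => (b : {ptws X -> R^o})) (fun f => f z)).
  exact: (@initial_continuous _ {ptws X -> R^o} (fun b : dual X => b : X -> R^o)).
exact: (@proj_continuous X (fun=> R^o) z).
Qed.

Lemma cvg_dual {Y} (F : set_system Y) {FF : Filter F} (b : Y -> dual X) (l : dual X) :
  (forall z, b p z @[p --> F] --> l z) -> b p @[p --> F] --> l.
Proof.
move=> bl A [_ [[B oB <-] Bl BA]].
have cB : (fun p => b p : {ptws X -> R^o}) @ F --> (l : {ptws X -> R^o}).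
  by apply/pointwise_cvgP => z; exact: bl.
have FB := cB B (open_nbhs_nbhs (conj oB Bl)).
by apply: (@filterS _ F FF _ (b @^-1` A) _ FB) => p; exact: BA.
Qed.

Lemma closure_dual_le (C : set (dual X)) (l : dual X) (z : X) (a : R) :
  (forall b, C b -> b z <= a) -> closure C l -> l z <= a.
Proof.
move=> Ca Cl.
have : closed ((fun b : dual X => (b z : R^o)) @^-1` [set x | x <= a]).
  apply: (@closed_comp (dual X) R^o) => [b _|]; last exact: closed_le.
  exact: dual_eval_continuous.
by move=> /closure_id clE; have /= := closure_subset Ca Cl; rewrite -clE.
Qed.

End WeakStarTopology.

Lemma cvg_near_le {R : realType} {Y} (F : set_system Y) {FF : ProperFilter F}
    (h : Y -> R^o) (a M : R) :
  h p @[p --> F] --> (a : R^o) -> (\forall p \near F, h p <= M) -> a <= M.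
Proof.
move=> ha hM; apply: (@closed_cvg Y R^o F FF h (fun x => x <= M) _ hM a ha).
exact: closed_le.
Qed.

Lemma cvg_sum_ord {R : realType} {Y} (F : set_system Y) {FF : Filter F} n
    (h : 'I_n -> Y -> R^o) (a : 'I_n -> R) :
  (forall i, h i p @[p --> F] --> (a i : R^o)) ->
  \sum_i h i p @[p --> F] --> (\sum_i a i : R^o).
Proof.
move=> ha; apply: (@cvg_big R^o 'I_n (fun x y => x + y)) => //.
exact: add_continuous.
Qed.

Section UltrafilterLimits.
Context {Y : Type} (U : set_system Y) {UU : UltraFilter U}.

Lemma ultra_cvg_compact {T : topologicalType} (K : set T) (f : Y -> T) :
  compact K -> (\forall p \near U, K (f p)) ->
  exists2 t, K t & f p @[p --> U] --> t.
Proof.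
move=> cK UK; have [t [Kt clt]] := cK (f @ U) _ UK; exists t => // V Vt.
have [//|UNV] := in_ultra_setVsetC (f @^-1` V) UU.
by have [s [/= + Vs]] := clt (~` V) V UNV Vt.
Qed.

Context {R : realType}.

Lemma ultra_cvg_bounded (h : Y -> R^o) (B : R) :
  (\forall p \near U, `|h p| <= B) -> exists a : R, h p @[p --> U] --> (a : R^o).
Proof.
move=> hB; have [||t _ ct] := @ultra_cvg_compact R^o `[- B, B]%classic h.
- exact: segment_compact.
- by apply: filterS hB => p; rewrite /= in_itv/= ler_norml.
- by exists t.
Qed.

(** The Banach-Alaoglu theorem: a bound from above near [y] together with a
    bound from below at [y] bounds the family at every point, so that it
    converges pointwise along the ultrafilter; the limit inherits the upper
    bound, hence is continuous. *)
Theorem ultra_dual_limit {X : tvsType R} (b : Y -> dual X) (y : X) (V : set X)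
    (A M : R) : nbhs y V ->
  (\forall p \near U, A <= b p y /\ forall z, V z -> b p z <= M) ->
  exists l : dual X, forall z, b p z @[p --> U] --> l z.
Proof.
move=> yV UAM.
have ub z : exists B, \forall p \near U, b p z <= B.
  have [k k0 Vk] := nbhs_ray z yV; exists ((M - A) / k).
  apply: filterS UAM => p [Ap /(_ _ Vk)]; rewrite dual_appD dual_appZ => bM.
  by rewrite ler_pdivlMr// mulrC; lra.
have /choice[h hl] z : exists a : R, b p z @[p --> U] --> (a : R^o).
  have [B1 ub1] := ub z; have [B2 ub2] := ub (- z).
  apply: (@ultra_cvg_bounded _ (Num.max B1 B2)); near=> p.
  have H1 : b p z <= B1 by near: p.
  have H2 : b p (- z) <= B2 by near: p.
  move: H2; rewrite -scaleN1r dual_appZ mulN1r => H2.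
  by rewrite ler_norml lerNl !le_max H1 H2 orbT.
have lin_h : linear (h : X -> R^o).
  move=> s u v; apply: (cvg_unique _ (hl _)) => //=.
  under eq_fun do rewrite dual_appD dual_appZ.
  apply: cvgD; last exact: hl.
  by apply: cvgM; [exact: cvg_cst|exact: hl].
have [|l lE] := @ex_dual _ _ (h : X -> R^o) lin_h.
  apply: (@linear_near_bounded_continuous _ _ _ y M) => //.
  apply: filterS yV => z Vz.
  apply: (cvg_near_le (hl z)).
  by apply: filterS UAM => p [_]; exact.
by exists l => z; rewrite lE.
Unshelve. all: by end_near. Qed.

End UltrafilterLimits.

(** * Convex hulls and families of convex functions *)

Section ConvexHull.
Context {R : realType} {V : lmodType R}.
Implicit Types A B : set V.

Lemma sub_convex_hull A : A `<=` convex_hull A.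
Proof. by move=> v Av B [_]; exact. Qed.

Lemma convex_hull_min A B : convex_set B -> A `<=` B -> convex_hull A `<=` B.
Proof. by move=> cB AB v; apply. Qed.

Lemma convex_hull_convex A : convex_set (convex_hull A).
Proof.
apply/convex_setP => s u v s0 s1 Au Av B [cB AB]; move/convex_setP: (cB); apply => //.
  exact: Au.
exact: Av.
Qed.

End ConvexHull.

Section ExtendedReals.
Context {R : realType}.

Lemma lte_fin_dense (x : \bar R) (b : R) : (x < b%:E)%E ->
  exists2 a : R, (x < a%:E)%E & a < b.
Proof.
case: x => [r| |]//; rewrite ?lte_fin => rb; last by exists (b - 1); [rewrite ltNyr|lra].
by exists ((r + b) / 2); [rewrite lte_fin; lra|lra].
Qed.

Lemma lte_dense_fin (x y : \bar R) : (x < y)%E ->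
  exists2 a : R, (a%:E < y)%E & (x < a%:E)%E.
Proof.
case: y => [r /lte_fin_dense[a xa ar]| xy|]; first by exists a.
- case: x xy => [r _| |]//.
    by exists (r + 1); rewrite ?ltry// lte_fin; lra.
  by exists 0; rewrite ?ltry ?ltNyr.
- by rewrite ltNge leNye.
Qed.

Lemma sup_fun_ub {X T : Type} (f : T -> X -> \bar R) t z :
  (f t z <= sup_fun f z)%E.
Proof. by apply: ereal_sup_ubound; exists t. Qed.

Lemma edom_sup_funP {X T : Type} (f : T -> X -> \bar R) z :
  edom (sup_fun f) z <-> exists M : R, forall t, (f t z <= M%:E)%E.
Proof.
split=> [|[M fM]].
  rewrite /edom/=; have := sup_fun_ub f ^~ z.
  case: (sup_fun f z) => [M| |]// ub _; first by exists M.
  by exists 0 => t; apply: (le_trans (ub t)); rewrite leNye.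
apply: (@le_lt_trans _ _ M%:E); last by rewrite ltry.
by apply: ge_ereal_sup => _ [t _ <-].
Qed.

End ExtendedReals.

Section ConvexRays.
Context {R : realType} {X : lmodType R} (phi : X -> \bar R).
Hypothesis cphi : convex_efun phi.

Lemma convex_efun_shrink y (s a : R) : (phi 0%R <= 0)%E -> 0 <= s -> s <= 1 ->
  (phi y <= a%:E)%E -> (phi (s *: y)%R <= (s * a)%:E)%E.
Proof.
move=> phi0 s0 s1 phiy; move/convex_efunP: cphi => /(_ s y 0 a 0 s0 s1 phiy phi0).
by rewrite scaler0 mulr0 !addr0.
Qed.

(** A convex function may jump only upwards at the end of a segment of its
    domain, so that a lower bound along the ray passes to the end point. *)
Lemma convex_efun_ray_ge0 y (c M : R) : (phi y <= M%:E)%E ->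
  (forall r, 0 < r -> r <= 1 -> ((r * c)%:E <= phi (r *: y)%R)%E) ->
  (0 <= phi 0%R)%E.
Proof.
move=> phiM phic; rewrite leNgt; apply/negP => /lte_fin_dense[a /ltW phia a0].
(* At q := - a / (k - a) the chord from (0, a) to (1, M) is below q c. *)
pose k := `|M - c - a| + 1.
have k1 : 1 <= k by rewrite lerDr.
have kM : M - c - a <= k - 1 by rewrite addrK ler_norm.
have q0 : 0 < - a / (k - a).
  by rewrite divr_gt0 ?oppr_gt0//; lra.
have q1 : - a / (k - a) <= 1 by rewrite ler_pdivrMr; lra.
have := phic _ q0 q1; move/convex_efunP: cphi => /(_ _ _ _ _ _ (ltW q0) q1 phiM phia).
rewrite scaler0 addr0 => /[swap] /le_trans /[apply]; rewrite lee_fin.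
set q := - a / (k - a) in q0 q1 *.
have qk : q * (k - a) = - a by rewrite divfK// gt_eqF//; lra.
have := ler_wpM2l (ltW q0) kM.
by nra.
Qed.

End ConvexRays.

Lemma segment_limit_le0 {R : realType} (p q : R) :
  (forall s, 0 < s -> s <= 1 -> s * p + (1 - s) * q <= 0) -> q <= 0.
Proof.
move=> pq; rewrite leNgt; apply/negP => q0.
have k0 : 0 < q + `|p| + 1 by rewrite ltr_pwDr// addr_ge0// ltW.
(* This makes s (q - p) < q, that is, the combination positive. *)
pose s := q / (q + `|p| + 1) / 2.
have s0 : 0 < s by rewrite !divr_gt0.
have sk : s * (q + `|p| + 1) * 2 = q by rewrite /s; field; rewrite gt_eqF.
have s1 : s <= 1.
  by rewrite /s ler_pdivrMr// ler_pdivrMr//; have := normr_ge0 p; nra.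
have := pq _ s0 s1; have := ler_norm (- p); rewrite normrN => Np.
have := ler_wpM2l (ltW s0) Np.
by nra.
Qed.

Section BoundedFamily.
Context {R : realType} {X : tvsType R} {T : topologicalType}.
Variable g : T -> X -> \bar R.

(** When the functions are convex and their supremum is finite and continuous
    at some point, this is the interior of the domain of the supremum. *)
Definition locally_bounded_above : set X :=
  [set z | exists M : R, \forall u \near z, forall t, (g t u <= M%:E)%E].

Lemma locally_bounded_above_dom : locally_bounded_above `<=` edom (sup_fun g).
Proof. by move=> z [M /nbhs_singleton gM]; apply/edom_sup_funP; exists M. Qed.

Hypothesis gcvx : forall t, convex_efun (g t).

Lemma edom_sup_fun_convex : convex_set (edom (sup_fun g)).
Proof.
apply/convex_setP => s u v s0 s1 /edom_sup_funP[M gM] /edom_sup_funP[N gN].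
apply/edom_sup_funP; exists (s * M + (1 - s) * N) => t.
by have /convex_efunP := @gcvx t; apply.
Qed.

Lemma locally_bounded_above_segment (s : R) u v : 0 < s -> s <= 1 ->
  locally_bounded_above u -> edom (sup_fun g) v ->
  locally_bounded_above (s *: u + (1 - s) *: v).
Proof.
move=> s0 s1 [M gM] /edom_sup_funP[N gN].
exists (s * M + (1 - s) * N).
have sV : s != 0 by rewrite gt_eqF.
have := @nbhs_scaling _ _ s^-1 (- (s^-1 *: ((1 - s) *: v)))
  (s *: u + (1 - s) *: v) [set u | forall t, (g t u <= M%:E)%E].
rewrite scalerDr addrK scalerA mulVf// scale1r => /(_ gM).
apply: filterS => z /= Hz t; have /convex_efunP := @gcvx t.
move=> /(_ s _ v _ N (ltW s0) s1 (Hz t) (gN t)).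
by rewrite scalerBr scalerA divff// scale1r scalerA divff// scale1r subrK.
Qed.

Lemma locally_bounded_above_convex : convex_set locally_bounded_above.
Proof.
apply/convex_setP => s u v; rewrite le_eqVlt => /predU1P[<- _ _|s0 s1 Iu Iv].
  by rewrite scale0r add0r subr0 scale1r.
by apply: locally_bounded_above_segment => //; exact: locally_bounded_above_dom.
Qed.

Lemma dual_le_on_dom (l b : dual X) y0 : locally_bounded_above y0 ->
  (forall z, locally_bounded_above z -> l z <= b z) ->
  forall z, edom (sup_fun g) z -> l z <= b z.
Proof.
move=> Iy0 lb z Dz; rewrite -subr_le0.
apply: (@segment_limit_le0 _ (l y0 - b y0)) => s s0 s1.
have := lb _ (locally_bounded_above_segment s0 s1 Iy0 Dz).
by rewrite !dual_appD !dual_appZ; nra.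
Qed.

End BoundedFamily.

(** * The Caratheodory theorem *)

Section Caratheodory.
Context {R : realType} {V : lmodType R}.
Implicit Types (A : set V) (m n : nat).

Definition convex_combination A m (v : V) :=
  exists (w : 'I_m -> R) (a : 'I_m -> V), [/\ forall i, 0 <= w i,
    \sum_i w i = 1, forall i, A (a i) & v = \sum_i w i *: a i].

Lemma convex_combinationS A m : convex_combination A m.+1 `<=` convex_combination A m.+2.
Proof.
move=> _ [w [a [w0 w1 Aa ->]]].
exists (fun i => oapp w 0 (unlift ord0 i)), (fun i => oapp a (a ord0) (unlift ord0 i)).
split=> [i||i|].
- by case: unliftP => [j|] _ //=.
- by rewrite big_ord_recl unlift_none add0r; under eq_bigr do rewrite liftK /=.
- by case: unliftP => [j|] _ //=.
- rewrite [RHS]big_ord_recl unlift_none scale0r add0r.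
  by apply: eq_bigr => i _; rewrite liftK.
Qed.

Lemma convex_hull_combination A v : convex_hull A v ->
  exists m, convex_combination A m.+1 v.
Proof.
move: v; apply: convex_hull_min.
  apply/convex_setP => s _ _ s0 s1 [m [w [a [w0 w1 Aa ->]]]] [n [z [b [z0 z1 Ab ->]]]].
  exists (m + n.+1)%N.
  pose W (i : 'I_(m.+1 + n.+1)) :=
    match fintype.split i with inl j => s * w j | inr j => (1 - s) * z j end.
  pose B (i : 'I_(m.+1 + n.+1)) := match fintype.split i with inl j => a j | inr j => b j end.
  have Wl i : W (lshift _ i) = s * w i by rewrite /W (unsplitK (inl i)).
  have Wr i : W (rshift _ i) = (1 - s) * z i by rewrite /W (unsplitK (inr i)).
  have Bl i : B (lshift _ i) = a i by rewrite /B (unsplitK (inl i)).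
  have Br i : B (rshift _ i) = b i by rewrite /B (unsplitK (inr i)).
  exists W, B; split.
  - by move=> i; rewrite /W; case: fintype.split => j; rewrite mulr_ge0// subr_ge0.
  - rewrite (@big_split_ord _ _ _ m.+1 n.+1) /=.
    under eq_bigr do rewrite Wl; under [X in _ + X]eq_bigr do rewrite Wr.
    by rewrite -!mulr_sumr w1 z1; ring.
  - by move=> i; rewrite /B; case: fintype.split.
  - rewrite (@big_split_ord _ _ _ m.+1 n.+1) /=.
    under [in RHS]eq_bigr do rewrite Wl Bl -scalerA.
    under [X in _ = _ + X]eq_bigr do rewrite Wr Br -scalerA.
    by rewrite -!scaler_sumr.
move=> v Av; exists 0%N, (fun=> 1), (fun=> v); split => //.
  by rewrite big_ord1.
by rewrite big_ord1 scale1r.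
Qed.

(** Moving the weights [w] along an affine dependence [u] does not change the
    combination; the first weight that vanishes is the one that minimizes
    [w i / u i] among the indices with [0 < u i]. *)
Lemma convex_combination_drop A m (w u : 'I_m.+1 -> R) (a : 'I_m.+1 -> V) :
  (forall i, 0 <= w i) -> \sum_i w i = 1 -> (forall i, A (a i)) ->
  (exists i, u i != 0) -> \sum_i u i = 0 -> \sum_i u i *: a i = 0 ->
  convex_combination A m (\sum_i w i *: a i).
Proof.
move=> w0 w1 Aa [k uk] u0 ua0.
have [i1 ui1] : exists i, 0 < u i.
  apply: contrapT => /forallNP uN; have {}uN i : u i <= 0.
    by rewrite leNgt; apply/negP; exact: uN.
  move: uk; rewrite -oppr_eq0 (@psumr_eq0P _ _ xpredT (fun i => - u i)) ?eqxx//.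
    by move=> i _; rewrite oppr_ge0.
  by rewrite sumrN u0 oppr0.
pose i0 := [arg min_(i < i1 | 0 < u i) (w i / u i)]%O.
have [ui0 min0] : 0 < u i0 /\ forall i, 0 < u i -> w i0 / u i0 <= w i / u i.
  by rewrite /i0; case: arg_minP.
pose t := w i0 / u i0; have t0 : 0 <= t by rewrite divr_ge0// ltW.
pose w' i := w i - t * u i.
have w'0 i : 0 <= w' i.
  rewrite subr_ge0; have [ui|ui] := ltP 0 (u i).
    by rewrite -ler_pdivlMr// min0.
  by apply: le_trans (w0 i); rewrite mulr_ge0_le0.
have w'i0 : w' i0 = 0 by rewrite /w' divfK ?subrr// gt_eqF.
exists (fun j => w' (lift i0 j)), (fun j => a (lift i0 j)); split => //.
- have : \sum_i w' i = 1 by rewrite sumrB -mulr_sumr u0 mulr0 subr0.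
  by rewrite (bigD1_ord i0)//= w'i0 add0r.
- have <- : \sum_i w' i *: a i = \sum_i w i *: a i.
    under eq_bigr do rewrite scalerBl -scalerA.
    by rewrite sumrB -scaler_sumr ua0 scaler0 subr0.
  by rewrite (bigD1_ord i0)//= w'i0 scale0r add0r.
Qed.

(** The coordinates [coord] stand for a dimension at most [n]. *)
Theorem caratheodory n (coord : {linear V -> 'rV[R]_n}) A : injective coord ->
  convex_hull A `<=` convex_combination A n.+1.
Proof.
move=> inj v /convex_hull_combination[m].
have down k : convex_combination A (n.+1 + k).+1 `<=` convex_combination A (n.+1 + k).
  move=> _ [w [a [w0 w1 Aa ->]]].
  (* A row vector in the left kernel of M is an affine dependence. *)
  pose M : 'M[R]_((n.+1 + k).+1, n + 1) := \matrix_i row_mx (coord (a i)) (const_mx 1).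
  have kerM : kermx M != 0.
    rewrite -mxrank_eq0 mxrank_ker subn_eq0 -ltnNge.
    by apply: leq_ltn_trans (rank_leq_col _) _; rewrite addn1 ltnS leq_addr.
  have /rowV0Pn[u uM u0] := kerM.
  have {}uM : u *m M = 0 by exact/sub_kermxP.
  have uE : u *m M = row_mx (coord (\sum_i u 0 i *: a i)) (const_mx (\sum_i u 0 i)).
    rewrite mulmx_sum_row; apply/rowP => j; rewrite summxE.
    under eq_bigr do rewrite mxE rowK mxE.
    rewrite [RHS]mxE; case: fintype.split => j'.
      rewrite linear_sum summxE.
      by under [RHS]eq_bigr do rewrite linearZ /= mxE.
    by rewrite !mxE; under eq_bigr do rewrite mulr1.
  have [ua us] : coord (\sum_i u 0 i *: a i) = 0 /\
      const_mx (\sum_i u 0 i) = 0 :> 'rV[R]_1.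
    by apply: eq_row_mx; rewrite -uE uM row_mx0.
  apply: (@convex_combination_drop A (n.+1 + k) w (u 0) a) => //.
  - by have /rV0Pn[i ui] := u0; exists i.
  - by have := congr1 (fun B : 'rV_1 => B 0 0) us; rewrite !mxE.
  - by apply: inj; rewrite ua linear0.
have [nm|mn] := leqP n m.
  rewrite -(subnKC nm) -addSn; elim: (m - n)%N => [|k IH]; first by rewrite addn0.
  by rewrite addnS => /down; exact: IH.
rewrite -(subnKC (ltnW mn)); elim: (n - m)%N => [|k IH]; first by rewrite addn0.
by move=> /IH; rewrite addnS; exact: convex_combinationS.
Qed.

End Caratheodory.

(** * Subgradients of the active functions

    The reference point is 0, where the supremum of the family [g] is 0, and [l]
    is a subgradient of the supremum at 0. *)

Section ActiveSubgradients.
Context {R : realType} {X : tvsType R} {T : topologicalType}.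
Variables (g : T -> X -> \bar R) (K : set T) (eps0 : R) (l : dual X) (y0 : X).
Hypothesis gcvx : forall t, convex_efun (g t).
Hypothesis g0_le0 : forall t, (g t 0%R <= 0)%E.
Hypothesis eps0_gt0 : 0 < eps0.
Hypothesis Kcompact : compact K.
Hypothesis K_active : forall t, ((- eps0)%:E <= g t 0%R)%E -> K t.
Hypothesis g_usc : forall z, locally_bounded_above g z ->
  upper_semicontinuous_on K (fun t => g t z).
Hypothesis l_le_sup : forall z (e : R), 0 < e -> exists t, ((l z - e)%:E < g t z)%E.
Hypothesis y0_int : locally_bounded_above g y0.

Lemma locally_bounded_above_ray y r : locally_bounded_above g y ->
  0 < r -> r <= 1 -> locally_bounded_above g (r *: y).
Proof.
move=> Iy r0 r1; have D0 : edom (sup_fun g) 0 by apply/edom_sup_funP; exists 0.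
have := locally_bounded_above_segment gcvx r0 r1 Iy D0.
by rewrite scaler0 addr0.
Qed.

(** This is where compactness enters.  The indices [t] for which
    [g t (s *: y)] is nearly above [s * l y] form the set [E s]; convexity on the
    ray makes [E] decreasing as [s] tends to 0, and puts [E s] inside [K] for
    small [s].  At a cluster point [t], upper semicontinuity preserves all the
    inequalities along the ray at once, and then convexity forces [t] to be
    active. *)
Lemma ex_active_above y : locally_bounded_above g y -> exists t, g t 0 = 0%E /\
  forall r, 0 <= r -> r <= 1 -> ((r * l y)%:E <= g t (r *: y)%R)%E.
Proof.
move=> Iy; have [M gM] : exists M, forall t, (g t y <= M%:E)%E.
  by apply/edom_sup_funP; exact: locally_bounded_above_dom.
pose E (s : R) := [set t | ((s * l y - s * s)%:E < g t (s *: y)%R)%E].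
(* For s <= s0 := eps0 / c, an index with g t 0 < - eps0 would stay below
   s l y - s s at s y, since g t y <= M. *)
pose c := `|M - l y| + eps0 + 1.
have c0 : 0 < c by rewrite ltr_pwDr// addr_ge0// ltW.
pose s0 := eps0 / c.
have s00 : 0 < s0 by rewrite divr_gt0.
have s0c : s0 * c = eps0 by rewrite divfK// gt_eqF.
have s01 : s0 <= 1 by rewrite ler_pdivrMr// mul1r /c; have := normr_ge0 (M - l y); lra.
have EK s : 0 < s -> s <= s0 -> E s `<=` K.
  move=> sp ss0 t Et; apply: K_active; rewrite leNgt; apply/negP => /ltW gt.
  have s1 := le_trans ss0 s01.
  have /convex_efunP := @gcvx t.
  move=> /(_ _ _ _ _ _ (ltW sp) s1 (gM t) gt); rewrite scaler0 addr0.
  move=> /(lt_le_trans Et); rewrite lte_fin => H.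
  have := ler_norm (M - l y); rewrite -(ler_pM2l sp) => H1.
  have : s * c <= eps0 by rewrite -s0c ler_pM2r.
  by rewrite /c; nra.
have slope t (s r a : R) : 0 < s -> s <= r -> (g t (r *: y)%R <= a%:E)%E ->
    (g t (s *: y)%R <= (s / r * a)%:E)%E.
  move=> sp sr ga; have rp := lt_le_trans sp sr.
  have -> : s *: y = (s / r) *: (r *: y) by rewrite scalerA divfK// gt_eqF.
  apply: convex_efun_shrink => //; first by rewrite divr_ge0// ltW.
  by rewrite ler_pdivrMr// mul1r.
have Emono s r : 0 < s -> s <= r -> E s `<=` E r.
  move=> sp sr t Et; rewrite /E/= ltNge; apply/negP => /(slope _ _ _ _ sp sr).
  move=> /(lt_le_trans Et); rewrite lte_fin.
  have -> : s / r * (r * l y - r * r) = s * l y - s * r.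
    by field; rewrite gt_eqF// (lt_le_trans sp).
  by have := ler_wpM2l (ltW sp) sr; lra.
pose F := filter_from [set s : R | 0 < s /\ s <= s0] E.
have FF : ProperFilter F.
  apply: filter_from_proper; last first.
    move=> s [sp _]; have [t] := l_le_sup (s *: y) (mulr_gt0 sp sp).
    by rewrite dual_appZ; exists t.
  apply: filter_from_filter; first by exists s0.
  move=> s r [sp ss0] [rp rs0]; exists (Num.min s r).
    by rewrite /= lt_min sp rp ge_min ss0.
  move=> t Et; have mp : 0 < Num.min s r by rewrite lt_min sp rp.
  by split; apply: Emono Et => //; rewrite ge_min lexx// orbT.
have [|t [Kt clt]] := @Kcompact F FF.
  by exists s0 => //; apply: EK.
have gl r : 0 < r -> r <= 1 -> ((r * l y)%:E <= g t (r *: y)%R)%E.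
  move=> rp r1; rewrite leNgt; apply/negP => /lte_fin_dense[a gta al].
  have Ir := locally_bounded_above_ray Iy rp r1.
  pose s := Num.min s0 (Num.min r ((r * l y - a) / r)).
  have d0 : 0 < (r * l y - a) / r by rewrite divr_gt0// subr_gt0.
  have sp : 0 < s by rewrite !lt_min s00 rp d0.
  have ss0 : s <= s0 by rewrite ge_min lexx.
  have sr : s <= r by rewrite !ge_min lexx orbT.
  have sd : s <= (r * l y - a) / r by rewrite !ge_min lexx !orbT.
  have FE : F (E s) by exists s.
  have [t' [Et' /= gt'a]] := clt _ _ FE (g_usc Ir Kt gta).
  have /ltW/slope := gt'a (EK _ sp ss0 _ Et').
  move=> /(_ _ sp sr) /(lt_le_trans Et'); rewrite lte_fin.
  rewrite ler_pdivlMr// in sd.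
  have -> : s / r * a = s * (a / r) by ring.
  rewrite -mulrBr ltr_pM2l// ltr_pdivlMr//.
  by nra.
have gt0 : g t 0 = 0%E.
  apply/eqP; rewrite eq_le g0_le0/=.
  by apply: (convex_efun_ray_ge0 (phi := g t) _ (gM t) gl); exact: gcvx.
exists t; split => // r; rewrite le_eqVlt => /predU1P[<- _|]; last exact: gl.
by rewrite mul0r scale0r gt0.
Qed.

Definition active_minorants : set (dual X) :=
  [set b | exists2 t, g t 0 = 0%E & forall z, ((b z : R)%:E <= g t z)%E].

(** The sandwich theorem is applied on the segment from 0 to [y] only: this is
    the subdifferential of [g t] at 0 attaining its directional derivative along
    [y], an interior direction of the domain. *)
Lemma ex_active_minorant y : locally_bounded_above g y ->
  exists2 b, active_minorants b & l y <= b y.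
Proof.
move=> Iy; have [t [gt0 gl]] := ex_active_above Iy; have [M gM] := Iy.
have [||||z [r [r0 r1 ->]]|||b [bg lb]] := @sandwich _ _ (g t)
  [set z | exists r, [/\ 0 <= r, r <= 1 & z = r *: y]] l y M.
- exact: gcvx.
- exact: g0_le0.
- apply/convex_setP => s _ _ s0 s1 [r [r0 r1 ->]] [q [q0 q1 ->]].
  exists (s * r + (1 - s) * q); split; [nra|nra|].
  by rewrite !scalerA scalerDl.
- by exists 0; rewrite scale0r.
- by rewrite dual_appZ; exact: gl.
- by exists 1; rewrite scale1r.
- by apply: filterS gM => z; exact.
- exists b; first by exists t.
  by apply: lb; exists 1; rewrite scale1r.
Qed.

Lemma active_minorants_hull_le (M : R) z : (forall t, g t z <= M%:E)%E ->
  forall b, convex_hull active_minorants b -> b z <= M.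
Proof.
move=> gM; apply: convex_hull_min => [|b [t _ bg]].
  exact: dual_halfspace_convex.
by rewrite -lee_fin; exact: le_trans (bg z) (gM t).
Qed.

(** A convex combination of the points [y i] is again an interior point of the
    domain, for which a single active minorant works; minimax exchanges the
    weights on the points for a convex combination of minorants. *)
Lemma ex_hull_minorant m (y : 'I_m -> X) (e : R) :
  (forall i, locally_bounded_above g (y i)) -> 0 < e ->
  exists2 b, convex_hull active_minorants b & forall i, l (y i) - e < b (y i).
Proof.
move=> Iy e0.
have [||||b Cb be] := @finite_minimax R (dual X) (convex_hull active_minorants) m
  (fun i b => b (y i) - l (y i)) e _ _ _ _ e0.
- exact: convex_hull_convex.
- have [b Qb _] := ex_active_minorant y0_int.
  by exists b; exact: sub_convex_hull.
- move=> i s b c.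
  by have -> : (s *: b + (1 - s) *: c) (y i) = s * b (y i) + (1 - s) * c (y i);
    [|ring].
- move=> w w0 w1.
  have := convex_sum (locally_bounded_above_convex gcvx) w0 w1 Iy.
  move=> /ex_active_minorant[b Qb lb]; exists b; first exact: sub_convex_hull.
  move: lb; rewrite !dual_app_sum -subr_ge0 -sumrB => /le_trans; apply.
  by apply: ler_sum => i _; rewrite mulrBr.
- by exists b => // i; have := be i; lra.
Qed.

(** The sets of elements of the hull that are nearly above [l] on a finite set
    of interior points generate a proper filter. *)
Lemma ex_hull_ultrafilter : exists U : set_system (dual X), [/\ UltraFilter U,
  U (convex_hull active_minorants) &
  forall y e, locally_bounded_above g y -> 0 < e -> U [set b | l y - e < b y]].
Proof.
pose B (p : seq X * R) := [set b | convex_hull active_minorants b /\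
  forall y, y \in p.1 -> l y - p.2 < b y].
pose F := filter_from [set p : seq X * R |
  (forall y, y \in p.1 -> locally_bounded_above g y) /\ 0 < p.2] B.
have FF : ProperFilter F.
  apply: filter_from_proper; last first.
    move=> [s e] [/= Is e0].
    have [|b Cb be] := @ex_hull_minorant _ (fun i => tnth (in_tuple s) i) e _ e0.
      by move=> i; apply: Is; exact: mem_tnth.
    by exists b; split => // y /= ys; have /(tnthP (in_tuple s))[i ->] := ys; exact: be.
  apply: filter_from_filter; first by exists ([::], 1); split.
  move=> [s e] [s' e'] [/= Is e0] [/= Is' e'0].
  exists (s ++ s', Num.min e e').
    split => /=; last by rewrite lt_min e0.
    by move=> y; rewrite mem_cat => /orP[/Is|/Is'].
  move=> b [Cb /= H]; split; split => // y /= ys.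
    apply: le_lt_trans (H y _); last by rewrite mem_cat ys.
    by rewrite lerD2l lerN2 ge_min lexx.
  apply: le_lt_trans (H y _); last by rewrite mem_cat ys orbT.
  by rewrite lerD2l lerN2 ge_min lexx orbT.
have [U [UU FU]] := ultraFilterLemma FF; exists U; split => //.
  by apply: FU; exists ([::], 1) => // b [].
move=> y e Iy e0; apply: FU; exists ([:: y], e).
  by split => // z; rewrite inE => /eqP->.
by move=> b [_]; apply; rewrite inE.
Qed.

Theorem ex_closure_hull_minorant :
  exists2 b, closure (convex_hull active_minorants) b &
    forall z, edom (sup_fun g) z -> l z <= b z.
Proof.
have [U [UU UC Ul]] := ex_hull_ultrafilter; have [M gM] := y0_int.
have [|b bl] := @ultra_dual_limit _ U UU R X id y0 _ (l y0 - 1) M gM.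
  near=> c; split; first by apply: ltW; near: c; exact: Ul.
  by move=> z Vz; apply: active_minorants_hull_le Vz _ _; near: c.
exists b.
  have cb : c @[c --> U] --> b by exact: cvg_dual.
  by move=> A /cb UA; exact: filter_ex (filterI UC UA).
apply: (dual_le_on_dom gcvx y0_int) => z Iz.
apply/ler_addgt0Pr => e e0; rewrite -lerBlDr -lerN2.
have : - c z @[c --> U] --> (- b z : R^o) by apply: cvgN; exact: bl.
move=> /cvg_near_le; apply; near=> c; rewrite lerN2; apply: ltW.
by near: c; exact: Ul.
Unshelve. all: by end_near. Qed.

(** What becomes of one term [W b *: a b] of the combinations that represent
    the elements [b] of the hull, when [b] follows an ultrafilter.  If the limit
    weight [w] is positive, then [w^-1 *: c] is below [g t] on the domain, with
    [t] the limit of the indices, by upper semicontinuity at interior points and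
    then along segments; the sandwich theorem replaces it by a minorant of [g t]
    on the whole space.  If [w = 0], the minorants may escape to infinity, but
    [c] is then a normal form at 0, that is nonpositive on the domain. *)
Lemma active_family_limit (U : set_system (dual X)) (W : dual X -> R)
    (a : dual X -> dual X) (tau : dual X -> T) (w : R) (c : dual X) :
  UltraFilter U ->
  (\forall b \near U, [/\ 0 <= W b, g (tau b) 0 = 0%E &
     forall z, ((a b z : R)%:E <= g (tau b) z)%E]) ->
  W b @[b --> U] --> (w : R^o) ->
  (forall z, W b * a b z @[b --> U] --> (c z : R^o)) ->
  exists2 b', active_minorants b' &
    forall z, edom (sup_fun g) z -> c z <= w * b' z.
Proof.
move=> UU Ua Ww ac.
have w0 : 0 <= w.
  rewrite -oppr_le0; apply: (cvg_near_le (cvgN Ww)).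
  by apply: filterS Ua => b [Wb _ _]; rewrite oppr_le0.
move: w0; rewrite le_eqVlt => /predU1P[w0|wp].
  have [b' Qb' _] := ex_active_minorant y0_int; exists b' => // z.
  move=> /edom_sup_funP[M gM]; rewrite -w0 mul0r.
  have cM : W b * a b z - W b * M @[b --> U] --> (c z - w * M : R^o).
    apply: cvgB; first exact: ac.
    by apply: cvgM => //; exact: cvg_cst.
  have -> : c z = c z - w * M by rewrite -w0 mul0r subr0.
  apply: (cvg_near_le cM); apply: filterS Ua => b [Wb _ ab].
  rewrite subr_le0 ler_wpM2l// -lee_fin.
  exact: le_trans (ab z) (gM _).
have [t Kt tt] : exists2 t, K t & tau b @[b --> U] --> t.
  apply: ultra_cvg_compact => //; apply: filterS Ua => b [_ gb _].
  by apply: K_active; rewrite gb lee_fin oppr_le0 ltW.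
pose d : dual X := w^-1 *: c.
have dE z : d z = w^-1 * c z by [].
have wd z : w * d z = c z by rewrite dE mulrA divff ?mul1r// gt_eqF.
have dI z : locally_bounded_above g z -> ((d z : R)%:E <= g t z)%E.
  move=> Iz; rewrite leNgt; apply/negP => /lte_fin_dense[r gr rd].
  have : c z <= w * r.
    rewrite -subr_le0.
    have cr : W b * a b z - W b * r @[b --> U] --> (c z - w * r : R^o).
      apply: cvgB; first exact: ac.
      by apply: cvgM => //; exact: cvg_cst.
    apply: (cvg_near_le cr); near=> b.
    have [Wb gb ab] : [/\ 0 <= W b, g (tau b) 0 = 0%E &
      forall z, ((a b z : R)%:E <= g (tau b) z)%E] by near: b.
    rewrite subr_le0 ler_wpM2l// -lee_fin; apply: (le_trans (ab z)).
    have Kb : K (tau b) by apply: K_active; rewrite gb lee_fin oppr_le0 ltW.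
    apply: ltW; move: Kb; near: b; exact: (tt _ (g_usc Iz Kt gr)).
  by rewrite -wd ler_pM2l// leNgt rd.
have dD z : edom (sup_fun g) z -> ((d z : R)%:E <= g t z)%E.
  move=> Dz; rewrite leNgt; apply/negP => /lte_fin_dense[r /ltW gr].
  apply/negP; rewrite -leNgt -subr_le0.
  have /edom_sup_funP[M gM] := locally_bounded_above_dom y0_int.
  apply: (@segment_limit_le0 _ (d y0 - M)) => s s0 s1.
  have := dI _ (locally_bounded_above_segment gcvx s0 s1 y0_int Dz).
  have /convex_efunP := @gcvx t; move=> /(_ _ _ _ _ _ (ltW s0) s1 (gM t) gr).
  move=> /[swap] /le_trans /[apply]; rewrite lee_fin dual_appD !dual_appZ.
  by nra.
have gt0 : g t 0 = 0%E.
  have /edom_sup_funP[M gM] := locally_bounded_above_dom y0_int.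
  apply/eqP; rewrite eq_le g0_le0/=.
  apply: (@convex_efun_ray_ge0 _ _ (g t) _ y0 (d y0) M) => //.
  move=> r r0 r1; rewrite -dual_appZ; apply: dI.
  exact: locally_bounded_above_ray.
have [M gM] := y0_int.
have [||||||b' [bg db]] := @sandwich _ _ (g t) (edom (sup_fun g)) d y0 M (@gcvx t).
- exact: g0_le0.
- exact: edom_sup_fun_convex.
- by apply/edom_sup_funP; exists 0.
- exact: dD.
- exact: locally_bounded_above_dom.
- by apply: filterS gM => z; exact.
exists b'; first by exists t.
by move=> z Dz; rewrite -wd ler_pM2l// db.
Unshelve. all: by end_near. Qed.

(** When a fixed number of minorants suffices for every element of the hull, the
    limit of each weight, each minorant and each index can be taken separately,
    and the closure of the hull is no longer needed. *)
Theorem ex_hull_minorant_finite n :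
  convex_hull active_minorants `<=` convex_combination active_minorants n ->
  exists2 b, convex_hull active_minorants b &
    forall z, edom (sup_fun g) z -> l z <= b z.
Proof.
move=> hullE.
have [U [UU UC Ul]] := ex_hull_ultrafilter; have [M gM] := y0_int.
have [t0 _] := ex_active_above y0_int.
have /choice[rep repP] : forall b, exists p : ('I_n -> R) * ('I_n -> dual X) * ('I_n -> T),
    convex_hull active_minorants b ->
    [/\ forall i, 0 <= p.1.1 i, \sum_i p.1.1 i = 1,
     forall i, g (p.2 i) 0 = 0%E /\ forall z, ((p.1.2 i z : R)%:E <= g (p.2 i) z)%E &
     b = \sum_i p.1.1 i *: p.1.2 i].
  move=> b; have [Cb|nCb] := pselect (convex_hull active_minorants b); last first.
    by exists (fun=> 0, fun=> 0, fun=> t0).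
  have [w [a [w0 w1 Qa bE]]] := hullE _ Cb.
  have /choice[tau tauP] i : exists t, g t 0 = 0%E /\
      forall z, ((a i z : R)%:E <= g t z)%E by have [t gt0 ag] := Qa i; exists t.
  by exists (w, a, tau) => _; split.
pose W i b := (rep b).1.1 i; pose a i b := (rep b).1.2 i; pose tau i b := (rep b).2 i.
have W0 i b : convex_hull active_minorants b -> 0 <= W i b.
  by move=> /repP[+ _ _ _]; exact.
have W1 b : convex_hull active_minorants b -> \sum_i W i b = 1.
  by move=> /repP[].
have atau i b : convex_hull active_minorants b ->
    g (tau i b) 0 = 0%E /\ forall z, ((a i b z : R)%:E <= g (tau i b) z)%E.
  by move=> /repP[_ _ + _]; apply.
have bE b z : convex_hull active_minorants b -> b z = \sum_i W i b * a i b z.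
  by move=> /repP[_ _ _ {1}->]; rewrite dual_sum.
have Wle1 i b : convex_hull active_minorants b -> W i b <= 1.
  move=> Cb; rewrite -(W1 b Cb) (bigD1 i)//= lerDl sumr_ge0// => j _.
  exact: W0.
have /choice[w Ww] : forall i, exists w : R, W i b @[b --> U] --> (w : R^o).
  move=> i; apply: (@ultra_cvg_bounded _ U UU R (W i) 1).
  by apply: filterS UC => b Cb; rewrite ger0_norm ?W0// Wle1.
have WaM i b z (N : R) : convex_hull active_minorants b ->
    (forall t, (g t z <= N%:E)%E) -> W i b * a i b z <= `|N|.
  move=> Cb gN; have [_ /(_ z) ag] := atau i b Cb.
  have aN : a i b z <= `|N|.
    by apply: le_trans (ler_norm N); rewrite -lee_fin; exact: le_trans ag (gN _).
  have := ler_wpM2l (W0 i b Cb) aN => /le_trans; apply.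
  by rewrite ler_piMl// Wle1.
have /choice[c cE] : forall i, exists c : dual X, forall z,
    W i b * a i b z @[b --> U] --> (c z : R^o).
  move=> i; have := @ultra_dual_limit _ U UU R X (fun b => W i b *: a i b) y0 _
    (l y0 - 1 - \sum_(j < n) `|M|) `|M| gM.
  apply; near=> b; have Cb : convex_hull active_minorants b by near: b.
  split; last by move=> z gz; exact: (WaM i b z M).
  have : l y0 - 1 < b y0 by near: b; exact: Ul.
  rewrite (bE _ _ Cb) (bigD1 i)//= => lb.
  have H : \sum_(j | j != i) W j b * a j b y0 <= \sum_(j < n) `|M|.
    rewrite [leRHS](bigD1 i)//= -[leLHS]add0r lerD// ler_sum// => j _.
    by apply: WaM => //; exact: (nbhs_singleton gM).
  change (l y0 - 1 - \sum_(j < n) `|M| <= W i b * a i b y0).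
  by lra.
have w0 i : 0 <= w i.
  rewrite -oppr_le0; apply: (cvg_near_le (cvgN (Ww i))).
  by apply: filterS UC => b Cb; rewrite oppr_le0 W0.
have w1 : \sum_i w i = 1.
  have : \sum_i W i b @[b --> U] --> (\sum_i w i : R^o) by exact: cvg_sum_ord.
  have : \sum_i W i b @[b --> U] --> (1 : R^o).
    by apply: cvg_near_cst; apply: filterS UC => b; exact: W1.
  by move=> + /cvg_unique => + H; move=> /H; apply.
have /choice[b' b'P] : forall i, exists b', active_minorants b' /\
    forall z, edom (sup_fun g) z -> c i z <= w i * b' z.
  move=> i; have [|b' ? ?] := @active_family_limit U (W i) (a i) (tau i) (w i) (c i)
    UU _ (Ww i) (cE i); last by exists b'.
  by apply: filterS UC => b Cb; have [? ?] := atau i b Cb; split => //; exact: W0.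
exists (\sum_i w i *: b' i).
  apply: convex_sum => //; first exact: convex_hull_convex.
  by move=> i; apply: sub_convex_hull; have [] := b'P i.
apply: (dual_le_on_dom gcvx y0_int) => z Iz; rewrite dual_sum.
apply: (@le_trans _ _ (\sum_i c i z)); last first.
  by apply: ler_sum => i _; apply: (b'P i).2; exact: locally_bounded_above_dom.
have cz : \sum_i W i b * a i b z @[b --> U] --> (\sum_i c i z : R^o).
  by apply: cvg_sum_ord => i; exact: cE.
apply/ler_addgt0Pr => e e0; rewrite -lerBlDr -lerN2.
apply: (cvg_near_le (cvgN cz)); near=> b.
have Cb : convex_hull active_minorants b by near: b.
by rewrite lerN2 -bE//; apply: ltW; near: b; exact: Ul.
Unshelve. all: by end_near. Qed.

End ActiveSubgradients.

(** * The subdifferential of a supremum *)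

Section LscEnvelope.
Context {R : realType}.

Lemma lsc_envelope_le {X : topologicalType} (phi : X -> \bar R) z :
  (lsc_envelope phi z <= phi z)%E.
Proof. by apply: ge_ereal_sup => _ [h [_ hphi] <-]. Qed.

Lemma lsc_envelope_id {X : topologicalType} (phi : X -> \bar R) z :
  (forall a : R, a%:E < phi z -> \forall u \near z, a%:E < phi u)%E ->
  lsc_envelope phi z = phi z.
Proof.
move=> lsc_z; apply/eqP; rewrite eq_le lsc_envelope_le /= leNgt.
apply/negP => /lte_dense_fin[a aphi envl].
have : nbhs z [set u | (a%:E < phi u)%E] := lsc_z _ aphi.
rewrite nbhsE => -[V [oV Vz] Vphi].
(* A lower semicontinuous minorant of phi that takes the value a at z. *)
pose h u : \bar R := if u \in V then a%:E else -oo%E.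
have : (a%:E <= lsc_envelope phi z)%E.
  apply: ereal_sup_ubound; exists h; last by rewrite /h mem_set.
  split.
    move=> u r; rewrite /h; case: ifPn => [/set_mem Vu ra|]; last by [].
    exists V; first by exact: open_nbhs_nbhs.
    by move=> v Vv; rewrite mem_set.
  move=> u; rewrite /h; case: ifPn => [/set_mem/Vphi/ltW//|_]; exact: leNye.
by rewrite leNgt envl.
Qed.

(** If [phi u <= a < phi z] with [u] very close to [z], then the point
    [z + k (z - u)] is still close to [z], and convexity forces a value there
    that exceeds the bound [M] as soon as [k] is large. *)
Lemma convex_efun_lsc {X : tvsType R} (phi : X -> \bar R) z (M : R) :
  convex_efun phi -> (\forall u \near z, phi u <= M%:E)%E ->
  forall a : R, (a%:E < phi z)%E -> (\forall u \near z, a%:E < phi u)%E.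
Proof.
move=> cphi phiM a aphi.
have [r rphi ar] : exists2 r : R, (r%:E <= phi z)%E & a < r.
  case: (phi z) aphi => [r| |]//=; first by rewrite lte_fin => ar; exists r.
  by move=> _; exists (a + 1); [rewrite leey|lra].
pose k := (`|M - r| + 1) / (r - a).
have ra0 : 0 < r - a by rewrite subr_gt0.
have k0 : 0 < k by rewrite divr_gt0// ltr_pwDr.
have kE : k * (r - a) = `|M - r| + 1 by rewrite divfK// gt_eqF.
have := @nbhs_scaling _ _ (- k) ((1 + k) *: z) z [set u | (phi u <= M%:E)%E].
rewrite scaleNr scalerDl scale1r addrC addrK => /(_ phiM).
apply: filterS => u /= Hu; rewrite ltNge; apply/negP => phiu.
have := convex_efun_barycenter cphi k0 ltr01 phiu Hu.
have -> : (k + 1)^-1 *: (k *: u + 1 *: (- k *: u + (z + k *: z))) = z.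
  rewrite scale1r addrA scaleNr subrr add0r -{1}(scale1r z) -scalerDl.
  by rewrite scalerA (addrC 1) mulVf ?scale1r// gt_eqF// addr_gt0.
move=> /(le_trans rphi); rewrite lee_fin ler_pdivlMr ?addr_gt0//.
by have := ler_norm (M - r); nra.
Qed.

End LscEnvelope.

Section Reduction.
Context {R : realType} {X : tvsType R} {T : topologicalType}.
Variables (f_ : T -> X -> \bar R) (x : X).

Definition recentered (fx : R) (t : T) (z : X) : \bar R :=
  (f_ t (x + z)%R - fx%:E)%E.

Lemma recentered_le fx t z (a : R) :
  (recentered fx t z <= a%:E)%E = (f_ t (x + z)%R <= (a + fx)%:E)%E.
Proof. by rewrite /recentered leeBlDr// EFinD. Qed.

Lemma recentered_ge fx t z (a : R) :
  (a%:E <= recentered fx t z)%E = ((a + fx)%:E <= f_ t (x + z)%R)%E.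
Proof. by rewrite /recentered leeBrDr// EFinD. Qed.

Lemma recentered_lt fx t z (a : R) :
  (recentered fx t z < a%:E)%E = (f_ t (x + z)%R < (a + fx)%:E)%E.
Proof. by rewrite !ltNge recentered_ge. Qed.

Lemma recentered_convex fx t : convex_efun (f_ t) -> convex_efun (recentered fx t).
Proof.
move=> /convex_efunP cf; apply/convex_efunP => s u v a b s0 s1.
rewrite !recentered_le => fu fv.
have := cf _ _ _ _ _ s0 s1 fu fv.
have -> : s *: (x + u) + (1 - s) *: (x + v) = x + (s *: u + (1 - s) *: v).
  by rewrite !scalerDr addrACA -scalerDl subrKC scale1r.
have -> // : s * (a + fx) + (1 - s) * (b + fx) = s * a + (1 - s) * b + fx.
by ring.
Qed.

Lemma edom_recentered fx z :
  edom (sup_fun (recentered fx)) z <-> edom (sup_fun f_) (x + z).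
Proof.
split=> /edom_sup_funP[M fM]; apply/edom_sup_funP.
  by exists (M + fx) => t; rewrite -recentered_le.
by exists (M - fx) => t; rewrite recentered_le subrK.
Qed.

Lemma locally_bounded_recentered fx z :
  locally_bounded_above (recentered fx) z <-> locally_bounded_above f_ (x + z).
Proof.
split=> -[M fM].
  exists (M + fx).
  have := @nbhs_scaling _ _ 1 (- x) (x + z)
    [set u | forall t, (recentered fx t u <= M%:E)%E].
  rewrite scale1r addrC addKr => /(_ fM); apply: filterS => u /= Hu t.
  by have := Hu t; rewrite recentered_le scale1r addrC subrK.
exists (M - fx).
have := @nbhs_scaling _ _ 1 x z [set u | forall t, (f_ t u <= M%:E)%E].
rewrite scale1r addrC => /(_ fM); apply: filterS => u /= Hu t.
by rewrite recentered_le subrK; have := Hu t; rewrite scale1r addrC.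
Qed.

Lemma active_minorants_recentered fx : sup_fun f_ x = fx%:E ->
  active_minorants (recentered fx) =
  \bigcup_(t in active f_ x) subdifferential (f_ t) x.
Proof.
move=> fxE; have act t : recentered fx t 0 = 0%E <-> f_ t x = fx%:E.
  rewrite /recentered addr0; split=> [|->]; last by rewrite subee.
  by case: (f_ t x) => [r| |]//= /eqP; rewrite -EFinB eqe subr_eq0 => /eqP->.
apply/seteqP; split => [b [t /act ft bf]|b [t]]; rewrite /active/= fxE.
  exists t => //; rewrite /subdifferential/= ft; split => // y.
  by have := bf (y - x); rewrite /recentered subrKC.
move=> ft [_ bf]; exists t; first exact/act.
by move=> z; have := bf (x + z); rewrite ft addrAC subrr add0r.
Qed.

(** The inequality [b (y - x) <= f y - f x] holds for the active subgradients,
    and cuts out a weak* closed half-space of [b]; adding a normal form can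
    only improve it for [y] in the domain. *)
Lemma subdifferential_sup_ge :
  minkowski_sum (normal_cone (edom (sup_fun f_)) x)
    (weakstar_closed_convex_hull
      (\bigcup_(t in active f_ x) subdifferential (f_ t) x)) `<=`
  subdifferential (sup_fun f_) x.
Proof.
move=> _ [a [Dx aN] [b bQ <-]].
set Q := \bigcup_(t in _) _ in bQ.
have [c [t tact [ftx cs]]] : Q !=set0.
  apply: contrapT => /set0P/negP/negPn/eqP Q0; move: bQ.
  rewrite /weakstar_closed_convex_hull Q0 => /(_ setT filterT) [c [+ _]].
  by move=> /(_ set0); apply; split => //; apply/convex_setP.
have fxfin : sup_fun f_ x \is a fin_num by rewrite -tact.
have fxE := fineK fxfin; set fx := fine _ in fxE.
split => // y.
case fyE : (sup_fun f_ y) => [fy| |].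
- rewrite -fxE -EFinB lee_fin.
  have Dy : edom (sup_fun f_) y by rewrite /edom/= fyE ltry.
  have := aN _ Dy; suff : b (y - x) <= fy - fx.
    by move=> /[swap] aN0; change ((b (y - x) <= fy - fx) -> a (y - x) + b (y - x) <= fy - fx); lra.
  apply: closure_dual_le bQ; apply: convex_hull_min.
    exact: dual_halfspace_convex.
  move=> d [t' t'act [_ /(_ y) dy]].
  rewrite -lee_fin; apply: (le_trans dy); rewrite t'act -fxE EFinB leeB//.
  by rewrite -fyE sup_fun_ub.
- by rewrite -fxE addye// leey.
- have := cs y; have : f_ t y = -oo%E.
    by apply/eqP; rewrite -leeNy_eq -fyE sup_fun_ub.
  by move=> ->; rewrite tact -fxE.
Qed.

Lemma continuous_locally_bounded x0 : sup_fun f_ x0 \is a fin_num ->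
  {for x0, continuous (sup_fun f_)} -> locally_bounded_above f_ x0.
Proof.
move=> fx0 cf; exists (fine (sup_fun f_ x0) + 1).
set M := fine _ + 1.
have : nbhs (sup_fun f_ x0) [set y | (y < M%:E)%E].
  apply: open_nbhs_nbhs; split; first exact: open_ereal_lt_ereal.
  by rewrite /= EFinD fineK// lteDl// lte_fin.
move=> /cf fM; have {}fM : nbhs x0 [set u | (sup_fun f_ u < M%:E)%E] := fM.
apply: filterS fM => u /= /ltW fu t; apply: le_trans fu.
exact: sup_fun_ub.
Qed.

(** At an interior point of the domain the functions [f_ t] coincide with their
    lower semicontinuous envelopes, which are the ones assumed to be upper
    semicontinuous in [t]. *)
Lemma upper_semicontinuous_recentered (K : set T) fx :
  (forall t, convex_efun (f_ t)) ->
  (forall z, edom (lsc_envelope (sup_fun f_)) z ->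
    upper_semicontinuous_on K (fun t => lsc_envelope (f_ t) z)) ->
  forall z, locally_bounded_above (recentered fx) z ->
    upper_semicontinuous_on K (fun t => recentered fx t z).
Proof.
move=> fcvx fusc z /locally_bounded_recentered Iz.
have envE t : lsc_envelope (f_ t) (x + z) = f_ t (x + z).
  have [M fM] := Iz; apply: lsc_envelope_id; apply: (@convex_efun_lsc _ _ _ _ M) => //.
  by apply: filterS fM => u; exact.
have Dz : edom (lsc_envelope (sup_fun f_)) (x + z).
  apply: le_lt_trans (lsc_envelope_le _ _) _.
  exact: (locally_bounded_above_dom Iz).
move=> t Kt a; rewrite recentered_lt -envE => /(fusc _ Dz t Kt).
by apply: filterS => s; rewrite recentered_lt -envE.
Qed.

(** The hypotheses of the preceding part hold for the recentered family; the
    normal component of [l] is what remains after subtracting a minorant that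
    is above [l] on the domain. *)
Theorem subdifferential_sup_decomposition (eps0 : R) (l : dual X)
    (Q := \bigcup_(t in active f_ x) subdifferential (f_ t) x) :
  (forall t, convex_efun (f_ t)) ->
  (exists x0, sup_fun f_ x0 \is a fin_num /\ {for x0, continuous (sup_fun f_)}) ->
  0 < eps0 -> compact (eps_active f_ eps0 x) ->
  (forall z, edom (lsc_envelope (sup_fun f_)) z ->
    upper_semicontinuous_on (eps_active f_ eps0 x)
      (fun t => lsc_envelope (f_ t) z)) ->
  subdifferential (sup_fun f_) x l ->
  minkowski_sum (normal_cone (edom (sup_fun f_)) x)
    (weakstar_closed_convex_hull Q) l /\
  forall n, convex_hull Q `<=` convex_combination Q n ->
    minkowski_sum (normal_cone (edom (sup_fun f_)) x) (convex_hull Q) l.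
Proof.
move=> fcvx [x0 [fx0 cfx0]] eps0_gt0 Kc fusc [fxfin lf].
have fxE := esym (fineK fxfin); set fx := fine _ in fxE.
pose g := recentered fx.
have gcvx t : convex_efun (g t) by exact/recentered_convex/fcvx.
have g0 t : (g t 0%R <= 0)%E by rewrite recentered_le add0r addr0 -fxE sup_fun_ub.
have Kact t : ((- eps0)%:E <= g t 0%R)%E -> eps_active f_ eps0 x t.
  by rewrite recentered_ge addr0 /eps_active/= fxE addrC EFinD EFinN.
have gusc := upper_semicontinuous_recentered (fx := fx) fcvx fusc.
have lsup z (e : R) : 0 < e -> exists t, ((l z - e)%:E < g t z)%E.
  move=> e0; apply: contrapT => /forallNP H.
  have : (sup_fun f_ (x + z)%R <= (l z - e + fx)%:E)%E.
    apply: ge_ereal_sup => _ [t _ <-].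
    by rewrite -recentered_le leNgt; apply/negP; exact: H.
  have lz : ((l z : R)%:E <= sup_fun f_ (x + z)%R - fx%:E)%E.
    by have := lf (x + z); rewrite (addrC (x + z)) addKr fxE.
  case: (sup_fun f_ (x + z)) lz => [r| |]//; rewrite -?EFinB !lee_fin.
  by lra.
have y0I : locally_bounded_above g (x0 - x).
  by apply/locally_bounded_recentered; rewrite subrKC; exact: continuous_locally_bounded.
have QE := active_minorants_recentered fxE; rewrite -/Q -/g in QE.
have Dx : edom (sup_fun f_) x by rewrite /edom/= fxE ltry.
have split_l (b : dual X) : (forall z, edom (sup_fun g) z -> l z <= b z) ->
    normal_cone (edom (sup_fun f_)) x (l - b).
  move=> lb; split=> // y Dy; change (l (y - x) - b (y - x) <= 0).
  by rewrite subr_le0; apply: lb; apply/edom_recentered; rewrite subrKC.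
split=> [|n]; rewrite -QE.
  have [b Cb lb] := ex_closure_hull_minorant gcvx g0 eps0_gt0 Kc Kact gusc lsup y0I.
  by exists (l - b); [exact: split_l|exists b => //; exact: subrK].
move=> /(ex_hull_minorant_finite gcvx g0 eps0_gt0 Kc Kact gusc lsup y0I)[b Cb lb].
by exists (l - b); [exact: split_l|exists b => //; exact: subrK].
Qed.

End Reduction.

(** A linear form on ['rV_n] is determined by its [n] values on the unit
    vectors. *)
Lemma dual_row_combination (R : realType) (n : nat) (A : set (dual 'rV[R]_n)) :
  convex_hull A `<=` convex_combination A n.+1.
Proof.
pose coord (b : dual 'rV[R]_n) : 'rV[R]_n := \row_j b (delta_mx 0 j).
have lin_c : linear coord by move=> s b c; apply/rowP => j; rewrite !mxE.
have [L LE] := linear_bundle lin_c.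
apply: (@caratheodory _ _ n L); rewrite -LE => b c bc.
apply/val_inj/funext => z.
rewrite (row_sum_delta z).
have := dual_app_sum b (z 0) (delta_mx 0); have := dual_app_sum c (z 0) (delta_mx 0).
move=> /= -> ->; apply: eq_bigr => j _; congr (_ * _).
by have /rowP/(_ j) := bc; rewrite !mxE.
Qed.

Theorem theorem9 (R : realType) :
  (forall (X : tvsType R) (T : topologicalType) (f_ : T -> X -> \bar R),
    hausdorff_space X ->
    (forall t : T, convex_efun (f_ t)) ->
    (exists x0 : X, sup_fun f_ x0 \is a fin_num /\
                    {for x0, continuous (sup_fun f_)}) ->
    forall (x : X) (eps0 : R), 0 < eps0 ->
    compact (eps_active f_ eps0 x) ->
    (forall z : X, edom (lsc_envelope (sup_fun f_)) z ->
      upper_semicontinuous_on (eps_active f_ eps0 x)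
        (fun t : T => lsc_envelope (f_ t) z)) ->
    subdifferential (sup_fun f_) x =
    minkowski_sum
      (normal_cone (edom (sup_fun f_)) x)
      (weakstar_closed_convex_hull
        (\bigcup_(t in active f_ x) subdifferential (f_ t) x)))
  /\
  (forall (n : nat) (T : topologicalType) (f_ : T -> 'rV[R]_n -> \bar R),
    (forall t : T, convex_efun (f_ t)) ->
    (exists x0 : 'rV[R]_n, sup_fun f_ x0 \is a fin_num /\
                           {for x0, continuous (sup_fun f_)}) ->
    forall (x : 'rV[R]_n) (eps0 : R), 0 < eps0 ->
    compact (eps_active f_ eps0 x) ->
    (forall z : 'rV[R]_n, edom (lsc_envelope (sup_fun f_)) z ->
      upper_semicontinuous_on (eps_active f_ eps0 x)
        (fun t : T => lsc_envelope (f_ t) z)) ->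
    subdifferential (sup_fun f_) x =
    minkowski_sum
      (normal_cone (edom (sup_fun f_)) x)
      (convex_hull
        (\bigcup_(t in active f_ x) subdifferential (f_ t) x))).
Proof.
split=> [X T f_ _ fcvx fcont x eps0 eps0_gt0 Kc fusc|n T f_ fcvx fcont x eps0 eps0_gt0 Kc fusc];
  apply/seteqP; split => l.
- by move=> /(subdifferential_sup_decomposition fcvx fcont eps0_gt0 Kc fusc)[].
- exact: subdifferential_sup_ge.
- move=> /(subdifferential_sup_decomposition fcvx fcont eps0_gt0 Kc fusc)[_].
  by apply; exact: dual_row_combination.
- move=> [a Na [b Qb ab]]; apply: subdifferential_sup_ge.
  by exists a => //; exists b => //; exact: subset_closure.
Qed.
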